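(* Let $A$ be a DG algebra over a field $\mathbf{k}$ whose Hochschild cohomology $HH^*(A,A^\vee)$ is a BV-algebra with product $\cup$ and BV-operator the Connes operator $B^\vee$. Then the cyclic cohomology $HC^*(A)$ and the negative cyclic cohomology $HC^*_-(A)$ each have a natural graded Lie algebra structure given by $$\{x,y\}:=(-1)^{|x|}\,i(b(x)\cup b(y)),$$ where $b$ and $i$ are the maps to and from $HH^*(A,A^\vee)$ in the respective Connes long exact sequence.
   Context: $C_*(A,A)=A\otimes T(s\bar A)$ is the normalized Hochschild chain complex of $A$ ($\bar A=A/\mathbf{k}$, $s$ lowers degree by one), $C^*(A,A^\vee)=\mathrm{Hom}_{\mathbf{k}}(C_*(A,A),\mathbf{k})$ is the Hochschild cochain complex with coefficients in $A^\vee=\mathrm{Hom}_{\mathbf{k}}(A,\mathbf{k})$, with differential $d^\vee$ and cohomology $HH^*(A,A^\vee)$, and $B^\vee$ is the (signed) dual of the Connes operator $B(a_0[a_1,\dots,a_n])=\sum_{i=1}^{n+1}\pm1[a_i,\dots,a_n,a_0,\dots,a_{i-1}]$ (Koszul signs). With $v$ a formal variable of degree $-2$, the cyclic cochain complex is $CC^*(A)=(C^*(A,A^\vee)\otimes\mathbf{k}[v],\,d^\vee+vB^\vee)$ and the negative cyclic cochain complex is $CC^*_-(A)=(C^*(A,A^\vee)\otimes\mathbf{k}[v,v^{-1}]]/v\mathbf{k}[v],\,d^\vee+vB^\vee)$; their cohomologies are $HC^*(A)$ and $HC^*_-(A)$. Multiplication by $v$ is injective on $CC^*(A)$ with cokernel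 $C^*(A,A^\vee)$, and surjective on $CC^*_-(A)$ with kernel $C^*(A,A^\vee)$. Up to degree shifts, the resulting Connes long exact sequences have the form $$\cdots\to L\xrightarrow{v}L\xrightarrow{b}HH^*(A,A^\vee)\xrightarrow{i}L\xrightarrow{v}L\to\cdots,\qquad b\circ i=B^\vee,$$ with $L=HC^*(A)$ ($b$ = reduction mod $v$, $i$ = connecting map) or $L=HC_-^*(A)$ ($i$ = inclusion of the kernel, $b$ = connecting map). Degrees in $L$ are normalized so that $|b(x)|=|x|+1$. A graded Lie bracket is a bilinear bracket (here of even degree) with $\{x,y\}=-(-1)^{|x||y|}\{y,x\}$ and $\{x,\{y,z\}\}=\{\{x,y\},z\}+(-1)^{|x||y|}\{y,\{x,z\}\}$. A BV-algebra is a graded commutative associative algebra (possibly after a degree shift) with an operator $\Delta$ of degree $\pm1$ such that $\Delta^2=0$ and $\Delta(abc)=\Delta(ab)c+(-1)^{|a|}a\Delta(bc)+(-1)^{(|a|-1)|b|}b\Delta(ac)-\Delta(a)bc-(-1)^{|a|}a\Delta(b)c-(-1)^{|a|+|b|}ab\Delta(c)$. *)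

(* Defs.v *)
From HB Require Import structures.
From mathcomp Require Import all_boot all_order all_algebra.
From mathcomp Require Import generic_quotient ring_quotient.
From mathcomp Require Import boolp classical_sets functions.

Set Implicit Arguments.
Unset Strict Implicit.
Unset Printing Implicit Defensive.

Import GRing.Theory.
Local Open Scope ring_scope.
Local Open Scope quotient_scope.

(* Gradings are internal: [gr n] is the subspace of homogeneous elements of
   degree [n], and the space is the direct sum of these. *)

Section GradedAlgebra.
Variables (k : fieldType) (V : lmodType k).
Implicit Types (gr : int -> set V) (op : V -> V -> V).

Definition graded_space gr : Prop :=
  [/\ forall n, gr n 0 /\
        (forall (c : k) u v, gr n u -> gr n v -> gr n (c *: u + v)),
      forall v, exists (s : seq int) (f : int -> V),
        (forall n, gr n (f n)) /\ v = \sum_(n <- s) f n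
    & forall (s : seq int) (f : int -> V), uniq s -> (forall n, gr n (f n)) ->
        \sum_(n <- s) f n = 0 -> forall n, n \in s -> f n = 0].

Definition bilinear_op op : Prop :=
  (forall (c : k) x y z, op (c *: x + y) z = c *: op x z + op y z) /\
  (forall (c : k) x y z, op z (c *: x + y) = c *: op z x + op z y).

Definition graded_lie_algebra gr op : Prop :=
  [/\ graded_space gr /\ bilinear_op op,
      exists e : int, forall m n x y, gr m x -> gr n y ->
        gr (m + n + 2 * e) (op x y),
      forall m n x y, gr m x -> gr n y ->
        op x y = - ((-1) ^ (m * n) *: op y x)
    & forall m n p x y z, gr m x -> gr n y -> gr p z ->
        op x (op y z) = op (op x y) z + (-1) ^ (m * n) *: op y (op x z)].

(* No unit is required. *)
Definition BV_algebra gr op (Delta : V -> V) : Prop :=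
  [/\ [/\ graded_space gr, bilinear_op op
        & forall m n a b, gr m a -> gr n b -> gr (m + n) (op a b)],
      (forall m n a b, gr m a -> gr n b ->
         op a b = (-1) ^ (m * n) *: op b a) /\
      (forall a b c, op (op a b) c = op a (op b c)),
      (forall (c : k) a b, Delta (c *: a + b) = c *: Delta a + Delta b) /\
      (exists e : int, (e = 1 \/ e = -1) /\
         forall n a, gr n a -> gr (n + e) (Delta a)),
      forall a, Delta (Delta a) = 0
    & forall m n p a b c, gr m a -> gr n b -> gr p c ->
        Delta (op (op a b) c) =
            op (Delta (op a b)) c
          + (-1) ^ m *: op a (Delta (op b c))
          + (-1) ^ ((m - 1) * n) *: op b (Delta (op a c))
          - op (op (Delta a) b) c
          - (-1) ^ m *: op (op a (Delta b)) c
          - (-1) ^ (m + n) *: op (op a b) (Delta c)].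

End GradedAlgebra.

Section QuotientSpace.
Variables (k : fieldType) (V : lmodType k) (U : submodClosed V).

Definition submod_zmod : {pred V} := fun v => v \in U.

Fact submod_zmod_closed : zmod_closed submod_zmod.
Proof. exact: GRing.submod_closedB (GRing.submodClosedP U). Qed.
HB.instance Definition _ :=
  GRing.isZmodClosed.Build V submod_zmod submod_zmod_closed.

Definition quot_space := Quotient.quot submod_zmod.

HB.instance Definition _ := GRing.Zmodule.on quot_space.

Definition quot_pi (v : V) : quot_space := \pi_(Quotient.quot submod_zmod) v.

Definition quot_scale (c : k) (x : quot_space) : quot_space :=
  quot_pi (c *: repr (x : Quotient.quot submod_zmod)).

Fact quot_piE (u v : V) : (quot_pi u == quot_pi v) = (u - v \in U).
Proof. by rewrite /quot_pi -Quotient.idealrBE. Qed.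

Fact quot_piD : {morph quot_pi : u v / u + v}.
Proof. by move=> u v; rewrite /quot_pi Quotient.pi_add. Qed.

Fact quot_piP (x : quot_space) : exists v, x = quot_pi v.
Proof. by exists (repr (x : Quotient.quot submod_zmod)); rewrite /quot_pi reprK. Qed.

Fact pi_quot_scale (c : k) (v : V) : quot_scale c (quot_pi v) = quot_pi (c *: v).
Proof.
apply/eqP; rewrite quot_piE -scalerBr rpredZ // -quot_piE.
by rewrite /quot_pi reprK.
Qed.

Fact quot_scaleA c d (x : quot_space) :
  quot_scale c (quot_scale d x) = quot_scale (c * d) x.
Proof. by have [v ->] := quot_piP x; rewrite !pi_quot_scale scalerA. Qed.

Fact quot_scale1 : left_id 1 quot_scale.
Proof. by move=> x; have [v ->] := quot_piP x; rewrite pi_quot_scale scale1r. Qed.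

Fact quot_scaleDr : right_distributive quot_scale +%R.
Proof.
move=> c x y; have [u ->] := quot_piP x; have [v ->] := quot_piP y.
by rewrite -quot_piD !pi_quot_scale scalerDr quot_piD.
Qed.

Fact quot_scaleDl (x : quot_space) :
  {morph (fun c => quot_scale c x) : c d / c + d}.
Proof.
move=> c d; have [v ->] := quot_piP x.
by rewrite !pi_quot_scale scalerDl quot_piD.
Qed.

HB.instance Definition _ := GRing.Zmodule_isLmodule.Build k quot_space
  quot_scaleA quot_scale1 quot_scaleDr quot_scaleDl.

End QuotientSpace.

(* A complex is carried by the subspace [space] of an ambient vector space, on
   all of which its differential is given by a formula.  Stability of [space]
   under [diff] and [diff \o diff = 0] are not fields, as the subquotient
   [cohomology] makes sense without them; they hold for the Hochschild, cyclic
   and negative cyclic complexes. *)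
Record complex (k : fieldType) := Complex {
  ambient : lmodType k;
  space : submodClosed ambient;
  diff : {linear ambient -> ambient};
  homogeneous : int -> set ambient }.

Section Cohomology.
Variables (k : fieldType) (X : complex k).

Definition cocycle : {pred ambient X} :=
  [pred x | (x \in space X) && (diff X x == 0)].

Fact cocycle_submod_closed : submod_closed cocycle.
Proof.
split=> [|c u v]; rewrite !inE ?rpred0 ?linear0 ?eqxx //.
move=> /andP[Xu /eqP du] /andP[Xv /eqP dv].
by rewrite rpredD ?rpredZ //= linearP du dv scaler0 addr0.
Qed.
HB.instance Definition _ :=
  GRing.isSubmodClosed.Build k (ambient X) cocycle cocycle_submod_closed.

Record cocycles := Cocycle {
  cocycle_val :> ambient X;
  cocycle_valP : cocycle_val \in cocycle }.
HB.instance Definition _ := [isSub for cocycle_val].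
HB.instance Definition _ := [Choice of cocycles by <:].
HB.instance Definition _ := [SubChoice_isSubLmodule of cocycles by <:].

Definition coboundary : {pred cocycles} :=
  [pred z | `[< exists2 y, y \in space X & val z = diff X y >]].

Fact coboundary_submod_closed : submod_closed coboundary.
Proof.
split=> [|c u v].
  by apply/asboolP; exists 0; [exact: rpred0|rewrite linear0].
move=> /asboolP[y Xy uE] /asboolP[z Xz vE]; apply/asboolP.
exists (c *: y + z); first by rewrite rpredD ?rpredZ.
by rewrite !linearP -uE -vE.
Qed.
HB.instance Definition _ :=
  GRing.isSubmodClosed.Build k cocycles coboundary coboundary_submod_closed.

Definition cohomology : lmodType k := quot_space coboundary.

(* The class of a cocycle; 0 on other elements. *)
Definition coh_class (x : ambient X) : cohomology :=
  quot_pi coboundary (insubd (0 : cocycles) x).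

Definition coh_homogeneous (n : int) : set cohomology :=
  [set x | exists z, [/\ z \in cocycle, homogeneous n z & x = coh_class z]].

End Cohomology.

Arguments cocycle {k} X _.

(* The map induced in cohomology by a chain (or anti-chain) map. *)
Definition coh_map (k : fieldType) (X Y : complex k)
    (f : ambient X -> ambient Y) (x : cohomology X) : cohomology Y :=
  xget 0 [set y | exists z,
    [/\ z \in cocycle X, x = coh_class z & y = coh_class (f z)]].

(* The connecting map of a short exact sequence 0 -> X -f-> Y -g-> Z -> 0:
   lift a cocycle of Z along g, apply the differential of Y, and pull the
   result back along f. *)
Definition connecting (k : fieldType) (X Y Z : complex k)
    (f : ambient X -> ambient Y) (g : ambient Y -> ambient Z)
    (z : cohomology Z) : cohomology X :=
  xget 0 [set x | exists u v,
    [/\ v \in space Y, g v \in cocycle Z & z = coh_class (g v)] /\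
    [/\ u \in cocycle X, f u = diff Y v & x = coh_class u]].

(* Unital and associative, with differential of degree +1, so that all
   degrees are cohomological and s lowers degree by one.  Elements of an
   [algType] satisfy 1 != 0, as A / k presupposes. *)
Record dgAlgebra (k : fieldType) := DGAlgebra {
  dg_alg :> algType k;
  dg_gr : int -> set dg_alg;
  dg_d : {linear dg_alg -> dg_alg};
  dg_graded : graded_space dg_gr;
  dg_gr1 : dg_gr 0 1;
  dg_grM : forall m n a b, dg_gr m a -> dg_gr n b -> dg_gr (m + n) (a * b);
  dg_grd : forall n a, dg_gr n a -> dg_gr (n + 1) (dg_d a);
  dg_dd : forall a, dg_d (dg_d a) = 0;
  dg_leibniz : forall m a b, dg_gr m a ->
    dg_d (a * b) = dg_d a * b + (-1) ^ m *: (a * dg_d b) }.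

Section Hochschild.
Variables (k : fieldType) (A : dgAlgebra k).

(* A homogeneous element of A together with its degree. *)
Record homog := Homog {
  hdeg : int;
  hval : A;
  hvalP : dg_gr hdeg hval }.

Definition hone : homog := Homog (dg_gr1 A).
Definition hmul (a b : homog) : homog := Homog (dg_grM (hvalP a) (hvalP b)).
Definition hd (a : homog) : homog := Homog (dg_grd (hvalP a)).

(* [(a0, [:: a1; ...; an])] stands for a0[a1, ..., an].  These symbols, modulo
   multilinearity and a0[..., 1, ...] = 0, span C_*(A, A). *)
Definition hgen : Type := homog * seq homog.

(* Degree of a1[a2, ..., an] with all of its entries suspended. *)
Definition sdeg (l : seq homog) : int := \sum_(a <- l) (hdeg a - 1).

Definition hgen_deg (x : hgen) : int := hdeg x.1 + sdeg x.2.

(* [(e, x)] stands for (-1)^e x, and a sequence of these for their sum. *)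
Definition chain : Type := seq (int * hgen).

(* With e_i = |a0| + (|a1| - 1) + ... + (|a(i-1)| - 1), the differential is the
   sum of
   d0 (a0[a1, ..., an]) =
     (d a0)[a1, ..., an] - sum_(1 <= i <= n) (-1)^e_i a0[..., d ai, ...]
   and
   d1 (a0[a1, ..., an]) =
     (-1)^|a0| (a0 a1)[a2, ..., an]
     + sum_(2 <= i <= n) (-1)^e_i a0[..., a(i-1) ai, ...]
     - (-1)^(e_n (|an| - 1)) (an a0)[a1, ..., a(n-1)].
   The lists below are indexed from 0. *)
Definition hoch_d0 (x : hgen) : chain :=
  let: (a0, l) := x in
  (0, (hd a0, l)) ::
  [seq (1 + hgen_deg (a0, take i l),
        (a0, take i l ++ hd (nth hone l i) :: drop i.+1 l))
     | i <- iota 0 (size l)].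

Definition hoch_d1 (x : hgen) : chain :=
  let: (a0, l) := x in
  if l is a1 :: l' then
    let an := last a1 l' in
    let l'' := belast a1 l' in
    (hdeg a0, (hmul a0 a1, l')) ::
    rcons
      [seq (hgen_deg (a0, take i.+1 l),
            (a0, take i l ++ hmul (nth hone l i) (nth hone l i.+1)
                          :: drop i.+2 l))
         | i <- iota 0 (size l')]
      (1 + hgen_deg (a0, l'') * (hdeg an - 1), (hmul an a0, l''))
  else [::].

Definition hoch_d (x : hgen) : chain := hoch_d0 x ++ hoch_d1 x.

(* a0[a1, ..., an] |-> sum over 1 <= i <= n + 1 of
   +-1[ai, ..., an, a0, ..., a(i-1)], with the Koszul sign of this rotation of
   the suspended entries. *)
Definition connes_B (x : hgen) : chain :=
  let l := x.1 :: x.2 in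
  [seq (sdeg (take i l) * sdeg (drop i l), (hone, rot i l))
     | i <- iota 1 (size l)].

(* A linear form on C_*(A, A) is given by its values on generators. *)
Definition cofun : lmodType k := hgen -> k^o.

(* The (signed) transpose phi |-> (-1)^|phi| phi \o F of an operator F of odd
   degree; a homogeneous phi can be nonzero on a generator y only if
   |phi| = |y|. *)
Definition transpose (F : hgen -> chain) (phi : cofun) : cofun :=
  fun x => \sum_(t <- F x) (-1) ^ t.1 * ((-1) ^ hgen_deg t.2 * phi t.2).

Fact transpose_linear F : linear (transpose F).
Proof.
move=> c phi psi; apply/funext => x.
rewrite /transpose [RHS]/GRing.add /= [in RHS]/GRing.scale /=.
rewrite [X in _ = X + _]/GRing.scale /= mulr_sumr -big_split /=.
apply: eq_bigr => t _; rewrite [(_ + psi) _]/GRing.add /=.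
by rewrite [(c *: phi) _]/GRing.scale /= !mulrDr !(mulrCA c).
Qed.
HB.instance Definition _ F :=
  GRing.isLinear.Build k cofun cofun _ (transpose F) (transpose_linear F).

Definition hoch_dv : cofun -> cofun := transpose hoch_d.
HB.instance Definition _ := GRing.Linear.on hoch_dv.

Definition connes_Bv : cofun -> cofun := transpose connes_B.
HB.instance Definition _ := GRing.Linear.on connes_Bv.

(* Degrees on cochains are such that d^v has degree -1 and B^v degree +1, in
   accordance with |v| = -2. *)
Definition hoch_homogeneous (n : int) : set cofun :=
  [set phi | forall x, phi x != 0 -> hgen_deg x = n].

Definition lin_comb (c : k) (a b e : homog) : Prop :=
  [/\ hdeg a = hdeg e, hdeg b = hdeg e & hval e = c *: hval a + hval b].

(* Elements of C^*(A, A^v): linear forms on A tensor T(s(A / k)), that is,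
   multilinear ones vanishing when an entry in brackets is a scalar, which are
   finite sums of homogeneous ones. *)
Definition is_cochain (phi : cofun) : Prop :=
  [/\ forall c a b e l, lin_comb c a b e ->
        phi (e, l) = c * phi (a, l) + phi (b, l),
      forall c a b e a0 l r, lin_comb c a b e ->
        phi (a0, l ++ e :: r) = c * phi (a0, l ++ a :: r)
                                + phi (a0, l ++ b :: r),
      forall c e a0 l r, hval e = c%:A -> phi (a0, l ++ e :: r) = 0
    & exists s : seq int, forall x, phi x != 0 -> hgen_deg x \in s].

Definition cochain : {pred cofun} := [pred phi | `[< is_cochain phi >]].

Fact cochain_submod_closed : submod_closed cochain.
Proof.
split.
  apply/asboolP; split => //; rewrite /GRing.zero /=.
  - by move=> *; rewrite mulr0 addr0.
  - by move=> *; rewrite mulr0 addr0.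
  - by exists [::] => x; rewrite eqxx.
move=> c f g.
move=> /asboolP[f0 f1 f2 [s fs]] /asboolP[g0 g1 g2 [t gt]].
have E x : (c *: f + g) x = c * f x + g x by [].
apply/asboolP; split.
- move=> c' a b e l abe; rewrite !E (f0 _ _ _ _ _ abe) (g0 _ _ _ _ _ abe).
  by rewrite !mulrDr addrACA !(mulrCA c).
- move=> c' a b e a0 l r abe; rewrite !E.
  rewrite (f1 _ _ _ _ _ _ _ abe) (g1 _ _ _ _ _ _ _ abe).
  by rewrite !mulrDr addrACA !(mulrCA c).
- by move=> c' e a0 l r h; rewrite E (f2 _ _ _ _ _ h) (g2 _ _ _ _ _ h) mulr0 addr0.
- exists (s ++ t) => x; rewrite E mem_cat.
  case: (eqVneq (f x) 0) => [->|/fs -> //]; rewrite mulr0 add0r => /gt ->.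
  exact: orbT.
Qed.
HB.instance Definition _ :=
  GRing.isSubmodClosed.Build k cofun cochain cochain_submod_closed.

Definition hochschild : complex k := Complex cochain hoch_dv hoch_homogeneous.

Definition series : lmodType k := nat -> cofun.

(* [psi : series] stands for the sum of the (psi j) v^j. *)

Definition cyc_D (psi : series) : series := fun j =>
  hoch_dv (psi j) + (if j is i.+1 then connes_Bv (psi i) else 0).

Fact cyc_D_linear : linear cyc_D.
Proof.
have E c (f g : series) j : (c *: f + g) j = c *: f j + g j by [].
move=> c f g; apply/funext => -[|j]; rewrite E /cyc_D !E !linearP /=.
  by rewrite !addr0.
by rewrite addrACA -scalerDr.
Qed.
HB.instance Definition _ :=
  GRing.isLinear.Build k series series _ cyc_D cyc_D_linear.

Definition cyc_homogeneous (n : int) : set series :=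
  [set psi | forall j, hoch_homogeneous (n + 2 * j%:Z) (psi j)].

(* C^*(A, A^v) tensor k[v] *)
Definition is_cyc_cochain (psi : series) : Prop :=
  (forall j, psi j \in cochain) /\
  (exists N : nat, forall j, (N <= j)%N -> psi j = 0).

Definition cyc_cochain : {pred series} := [pred psi | `[< is_cyc_cochain psi >]].

Fact cyc_cochain_submod_closed : submod_closed cyc_cochain.
Proof.
split=> [|c f g].
  by apply/asboolP; split=> [j|]; [exact: (rpred0 cochain)|exists 0%N].
move=> /asboolP[f0 [M fM]] /asboolP[g0 [N gN]].
have E i : (c *: f + g) i = c *: f i + g i by [].
apply/asboolP; split=> [j|]; first by rewrite E rpredD ?rpredZ.
exists (maxn M N) => j; rewrite geq_max => /andP[Mj Nj].
by rewrite E fM // gN // scaler0 addr0.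
Qed.
HB.instance Definition _ :=
  GRing.isSubmodClosed.Build k series cyc_cochain cyc_cochain_submod_closed.

Definition cyclic : complex k := Complex cyc_cochain cyc_D cyc_homogeneous.

Definition cyc_v (psi : series) : series := fun j => if j is i.+1 then psi i else 0.
Definition cyc_mod_v (psi : series) : cofun := psi 0%N.

(* In the negative case, [psi] stands for the sum of the (psi j) v^(-j). *)

Definition neg_D (psi : series) : series := fun j =>
  hoch_dv (psi j) + connes_Bv (psi j.+1).

Fact neg_D_linear : linear neg_D.
Proof.
have E c (f g : series) j : (c *: f + g) j = c *: f j + g j by [].
move=> c f g; apply/funext => j; rewrite E /neg_D !E !linearP /=.
by rewrite addrACA -scalerDr.
Qed.
HB.instance Definition _ :=
  GRing.isLinear.Build k series series _ neg_D neg_D_linear.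

Definition neg_homogeneous (n : int) : set series :=
  [set psi | forall j, hoch_homogeneous (n - 2 * j%:Z) (psi j)].

(* C^*(A, A^v) tensor k[v, v^-1]] / v k[v]: as usual the tensor product is
   completed, so that the elements are the finite sums of homogeneous power
   series in v^-1. *)
Definition is_neg_cochain (psi : series) : Prop :=
  (forall j, psi j \in cochain) /\
  (exists s : seq int, forall j x, psi j x != 0 -> hgen_deg x + 2 * j%:Z \in s).

Definition neg_cochain : {pred series} := [pred psi | `[< is_neg_cochain psi >]].

Fact neg_cochain_submod_closed : submod_closed neg_cochain.
Proof.
split=> [|c f g].
  by apply/asboolP; split=> [j|]; [exact: (rpred0 cochain)|exists [::] => j x; rewrite eqxx].
move=> /asboolP[f0 [s fs]] /asboolP[g0 [t gt]].
have E i : (c *: f + g) i = c *: f i + g i by [].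
apply/asboolP; split=> [j|]; first by rewrite E rpredD ?rpredZ.
exists (s ++ t) => j x; rewrite E mem_cat.
have -> : (c *: f j + g j) x = c * f j x + g j x by [].
case: (eqVneq (f j x) 0) => [->|/fs -> //]; rewrite mulr0 add0r => /gt ->.
exact: orbT.
Qed.
HB.instance Definition _ :=
  GRing.isSubmodClosed.Build k series neg_cochain neg_cochain_submod_closed.

Definition negative_cyclic : complex k :=
  Complex neg_cochain neg_D neg_homogeneous.

Definition neg_v (psi : series) : series := fun j => psi j.+1.
Definition neg_incl (phi : cofun) : series := fun j => if j is 0%N then phi else 0.

Definition HH : lmodType k := cohomology hochschild.
Definition HC : lmodType k := cohomology cyclic.
Definition HCneg : lmodType k := cohomology negative_cyclic.

Definition HH_B : HH -> HH := @coh_map k hochschild hochschild connes_Bv.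

(* 0 -> CC -v-> CC -> C -> 0 *)
Definition HC_b : HC -> HH := @coh_map k cyclic hochschild cyc_mod_v.
Definition HC_i : HH -> HC := @connecting k cyclic cyclic hochschild cyc_v cyc_mod_v.

(* 0 -> C -> CC_- -v-> CC_- -> 0 *)
Definition HCneg_i : HH -> HCneg := @coh_map k hochschild negative_cyclic neg_incl.
Definition HCneg_b : HCneg -> HH :=
  @connecting k hochschild negative_cyclic negative_cyclic neg_incl neg_v.

(* Degrees on HH^*(A, A^v) are shifted by s, and degrees on HC and HC_- so that
   |b x| = |x| + 1: before these shifts b has degree 0 on HC and +1 on HC_-. *)
Definition HH_deg (s n : int) : set HH := @coh_homogeneous k hochschild (n - s).
Definition HC_deg (s n : int) : set HC := @coh_homogeneous k cyclic (n + 1 - s).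
Definition HCneg_deg (s n : int) : set HCneg :=
  @coh_homogeneous k negative_cyclic (n - s).

End Hochschild.

(* Main.v *)
(** Words a0, a1, ..., an carry a signed rotation T, and B^v is, up to sign, the
    cyclic sum N = 1 + T + T^2 + ... of phi(1[...]). The product of the j-th and
    (j+1)-st entries, as well as d of the j-th one, is T^j f T^(n-j) with f the
    same operation at the head of the word. As N T = T N = N, both d^v B^v and
    - B^v d^v reduce to N f N, the outer terms a0 a1 and an a0 of d(1[...])
    cancelling out after rotation, so that d^v and B^v anticommute. Hence
    b and i can be computed on cocycles: i b = 0 and b i = B^v.

    For a = b(x), c = b(y), e = b(z) one then has B^v a = B^v c = B^v e = 0 and
    i B^v = i b i = 0, and i applied to the BV identity for B^v(a c e)
    is the Jacobi identity. *)

From HB Require Import structures.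
From mathcomp Require Import all_boot all_order all_algebra.
From mathcomp Require Import boolp classical_sets functions.
From mathcomp Require Import zify ring.
Require Import Defs.

Set Implicit Arguments.
Unset Strict Implicit.
Unset Printing Implicit Defensive.

Import GRing.Theory.
Local Open Scope ring_scope.

(** The bracket has to be bilinear on all of L, while (-1)^|x| makes sense for homogeneous x only.
    The sign is therefore realized by a linear operator on cochains, multiplying each component by
    the sign of its degree. It anticommutes with the odd operators d^v and B^v, and v has even
    degree, so it descends to both cyclic cohomologies. The maps on cohomology are specified by
    relations between representatives, and become formulas only after explicit linear sections are
    chosen: constants for reduction mod v, and multiplication by v^-1 for v on the negative complex.
    With these, i(phi) = B^v phi and b(z) = z_0 in the cyclic case, while i(phi) = phi and b(z) =
    B^v z_0 in the negative one. Independence of the choices rests on d^v B^v = - B^v d^v and on B^v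
    B^v = 0, the latter a consequence of normalization. *)

Section Signs.
Variable k : fieldType.
Implicit Types m n q : int.

Lemma signD m n : (-1 : k) ^ (m + n) = (-1) ^ m * (-1) ^ n.
Proof. by rewrite expfzDr // oppr_eq0 oner_eq0. Qed.

Lemma sign_double q : (-1 : k) ^ (2 * q) = 1.
Proof. by rewrite -exprz_exp -[_ ^ 2]/(_ ^+ 2) sqrrN expr1n exp1rz. Qed.

(** Koszul signs are compared through this lemma: [q] is half the difference of the exponents, which
    leaves an integer identity for [ring]. *)
Lemma sign_eq q m n : m = n + 2 * q -> (-1 : k) ^ m = (-1) ^ n.
Proof. by move->; rewrite signD sign_double mulr1. Qed.

Lemma signS n : (-1 : k) ^ (1 + n) = - (-1) ^ n.
Proof. by rewrite signD expr1z mulN1r. Qed.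

Lemma sign_sqr n : (-1 : k) ^ n * (-1) ^ n = 1.
Proof. by rewrite -signD (@sign_eq n _ 0) // add0r mulr2n mulrDl mul1r. Qed.

End Signs.

(** * Cyclic words *)

Section Rotations.
Variables (k : fieldType) (A : dgAlgebra k).
Local Notation word := (seq (homog A)).
Implicit Types (G : word -> k) (l m p q r : word) (a b : homog A).

Lemma sdeg_cons a l : sdeg (a :: l) = hdeg a - 1 + sdeg l.
Proof. by rewrite /sdeg big_cons. Qed.

Lemma sdeg_nil : sdeg (Nil (homog A)) = 0.
Proof. by rewrite /sdeg big_nil. Qed.

Lemma sdeg_cat l m : sdeg (l ++ m) = sdeg l + sdeg m.
Proof. by rewrite /sdeg big_cat. Qed.

Lemma sdeg_rot i l : sdeg (rot i l) = sdeg l.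
Proof. by rewrite /rot sdeg_cat addrC -sdeg_cat cat_take_drop. Qed.

(** The first suspended letter passes all the others, with its Koszul sign. Rotation acts on
    functions of words rather than on words, so no linear span of words is required. *)
Definition rotate G : word -> k :=
  fun m => (-1) ^ (sdeg (take 1 m) * sdeg (drop 1 m)) * G (rot 1 m).

Definition cyclic_sum G : word -> k :=
  fun m => \sum_(i < size m) iter i rotate G m.

(** With this sign every term of d1 is, up to one global -1, a conjugate of [mul_head] by
    rotations. *)
Definition mul_head G : word -> k := fun m =>
  if m is a :: b :: r then (-1) ^ (hdeg a - 1) * G (hmul a b :: r) else 0.

Definition d_head G : word -> k := fun m =>
  if m is a :: r then G (hd a :: r) else 0.

Lemma iter_rotate_cat G p q :
  iter (size p) rotate G (p ++ q) = (-1) ^ (sdeg p * sdeg q) * G (q ++ p).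
Proof.
elim: p q => [|a p IH] q; first by rewrite sdeg_nil mul0r mul1r cats0.
rewrite /= /rotate /= drop0 take0 rot1_cons -cats1 -catA IH -catA mulrA -signD.
(* The letter [a] passes [p], and later [p] passes [a]: this sign occurs twice. *)
congr (_ * _); apply: (@sign_eq k ((hdeg a - 1) * sdeg p)).
by rewrite !sdeg_cat !sdeg_cons sdeg_nil; ring.
Qed.

Lemma iter_rotateE G i m : (i <= size m)%N ->
  iter i rotate G m = (-1) ^ (sdeg (take i m) * sdeg (drop i m)) * G (rot i m).
Proof.
by move=> le_im; rewrite -iter_rotate_cat size_takel // cat_take_drop.
Qed.

(** A full turn moves the whole word past the empty one, so it carries no sign. This periodicity is
    what lets N absorb rotations on either side. *)
Lemma iter_rotate_size G m : iter (size m) rotate G m = G m.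
Proof. by rewrite iter_rotateE // drop_size rot_size sdeg_nil mulr0 mul1r. Qed.

Lemma sum_iter_rotateS G m :
  \sum_(i < size m) iter i.+1 rotate G m = cyclic_sum G m.
Proof.
rewrite /cyclic_sum; have := iter_rotate_size G m.
case: (size m) => [|n] E; first by rewrite !big_ord0.
by rewrite big_ord_recr big_ord_recl addrC; congr (_ + _).
Qed.

Lemma rotate_cyclic_sum G : rotate (cyclic_sum G) = cyclic_sum G.
Proof.
apply/funext => m; rewrite -[RHS]sum_iter_rotateS.
by rewrite /rotate /cyclic_sum size_rot mulr_sumr.
Qed.

Lemma cyclic_sum_rotate G : cyclic_sum (rotate G) = cyclic_sum G.
Proof.
apply/funext => m; rewrite -[RHS]sum_iter_rotateS.
by apply: eq_bigr => i _; rewrite iterSr.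
Qed.

Lemma iter_rotate_cyclic_sum i G : iter i rotate (cyclic_sum G) = cyclic_sum G.
Proof. by elim: i => //= i ->; rewrite rotate_cyclic_sum. Qed.

Lemma cyclic_sum_iter_rotate i G : cyclic_sum (iter i rotate G) = cyclic_sum G.
Proof. by elim: i => //= i <-; rewrite cyclic_sum_rotate. Qed.

(** Rotations preserve length, so N at [m] sees only words as long as [m]. Formulas valid for one
    length can thus be used under N. *)
Lemma eq_cyclic_sum G G' m :
  (forall p, size p = size m -> G p = G' p) -> cyclic_sum G m = cyclic_sum G' m.
Proof.
move=> E; apply: eq_bigr => i _.
by rewrite !iter_rotateE 1?ltnW // E ?size_rot.
Qed.

Lemma cyclic_sum_scaler c G m :
  cyclic_sum (fun p => c * G p) m = c * cyclic_sum G m.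
Proof.
rewrite /cyclic_sum mulr_sumr; apply: eq_bigr => i _.
by rewrite !iter_rotateE 1?ltnW // mulrCA.
Qed.

Lemma cyclic_sumD G G' m :
  cyclic_sum (fun p => G p + G' p) m = cyclic_sum G m + cyclic_sum G' m.
Proof.
rewrite /cyclic_sum -big_split; apply: eq_bigr => i _.
by rewrite !iter_rotateE 1?ltnW // mulrDr.
Qed.

Lemma cyclic_sum_sum n (F : 'I_n -> word -> k) m :
  cyclic_sum (fun p => \sum_j F j p) m = \sum_j cyclic_sum (F j) m.
Proof.
rewrite /cyclic_sum exchange_big; apply: eq_bigr => i _.
rewrite iter_rotateE 1?ltnW // mulr_sumr; apply: eq_bigr => j _.
by rewrite iter_rotateE 1?ltnW.
Qed.

Lemma cyclic_sum_sign G m :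
  cyclic_sum (fun p => (-1) ^ sdeg p * G p) m = (-1) ^ sdeg m * cyclic_sum G m.
Proof.
rewrite /cyclic_sum mulr_sumr; apply: eq_bigr => i _.
by rewrite !iter_rotateE 1?ltnW // sdeg_rot mulrCA.
Qed.

(** Rotating [p] away and back gives the sign of [p] against the tail twice, except that the product
    has lost one suspension in between: this leaves (-1)^[sdeg p]. *)
Lemma mul_head_at G p a b r :
  iter (size p) rotate (mul_head (iter (size r).+1 rotate G)) (p ++ a :: b :: r)
  = (-1) ^ (sdeg p + (hdeg a - 1)) * G (p ++ hmul a b :: r).
Proof.
rewrite iter_rotate_cat /mul_head cat_cons cat_cons.
rewrite -[hmul a b :: r ++ p]/((hmul a b :: r) ++ p).
rewrite -[(size r).+1]/(size (hmul a b :: r)) iter_rotate_cat !mulrA -!signD.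
congr (_ * _); apply: (@sign_eq k (sdeg p * (sdeg (a :: b :: r)))).
by rewrite !sdeg_cons /=; ring.
Qed.

Lemma d_head_at G p a r :
  iter (size p) rotate (d_head (iter (size r).+1 rotate G)) (p ++ a :: r)
  = (-1) ^ sdeg p * G (p ++ hd a :: r).
Proof.
rewrite iter_rotate_cat /d_head cat_cons.
rewrite -[hd a :: r ++ p]/((hd a :: r) ++ p).
rewrite -[(size r).+1]/(size (hd a :: r)) iter_rotate_cat !mulrA -!signD.
congr (_ * _); apply: (@sign_eq k (sdeg p * (sdeg (a :: r)))).
by rewrite !sdeg_cons /=; ring.
Qed.

Lemma sum_iter_rotate_rev G m n : size m = n ->
  \sum_(j < n) iter (n - j) rotate G m = cyclic_sum G m.
Proof.
move<-; rewrite -sum_iter_rotateS (reindex_inj rev_ord_inj) /=.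
by apply: eq_bigr => j _; rewrite subKn.
Qed.

(* The identity b' N = N b of cyclic homology, in which [cyclic_sum] is N. *)
Lemma cyclic_sum_mul_head G m :
  cyclic_sum (fun p => \sum_(j < (size m).-1)
    iter j rotate (mul_head (iter ((size m).-1 - j) rotate G)) p) m
  = cyclic_sum (mul_head (cyclic_sum G)) m.
Proof.
(* N absorbs the outer T^j. The inner exponents left, from [(size m).-1] down to 1, fill one period
   for words shortened by a product. *)
rewrite cyclic_sum_sum; under eq_bigr do rewrite cyclic_sum_iter_rotate.
rewrite -cyclic_sum_sum; apply: eq_cyclic_sum => -[|a [|b r]] <- /=.
- by rewrite big_ord0.
- by rewrite big_ord0.
by rewrite -mulr_sumr sum_iter_rotate_rev.
Qed.

Lemma cyclic_sum_d_head G m :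
  cyclic_sum (fun p => \sum_(j < size m)
    iter j rotate (d_head (iter (size m - j) rotate G)) p) m
  = cyclic_sum (d_head (cyclic_sum G)) m.
Proof.
rewrite cyclic_sum_sum; under eq_bigr do rewrite cyclic_sum_iter_rotate.
rewrite -cyclic_sum_sum; apply: eq_cyclic_sum => -[|a r] <- /=.
  by rewrite big_ord0.
by rewrite sum_iter_rotate_rev.
Qed.

End Rotations.

Arguments rotate {k A}.

(** * d^v and B^v anticommute *)

Section Hochschild.
Variables (k : fieldType) (A : dgAlgebra k).
Local Notation word := (seq (homog A)).
Implicit Types (phi : cofun A) (F : hgen A -> chain A) (x : hgen A).
Implicit Types (l m p q r : word) (a b e : homog A) (c : k).

(** The degree has to be compared as well, since 0 is homogeneous of every degree. *)
Lemma homog_eq a b : hdeg a = hdeg b -> hval a = hval b -> a = b.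
Proof.
case: a b => [n v P] [n' v' P'] /= En Ev; case: _ / En P' => P'.
by case: _ / Ev P' => P'; rewrite (Prop_irrelevance P P').
Qed.

Lemma dg_d1 : dg_d A 1 = 0.
Proof.
have := dg_leibniz 1 (dg_gr1 A).
rewrite !mulr1 expr0z scale1r mul1r => /esym/(canRL (addKr _)).
by rewrite addNr.
Qed.

Lemma hmul1 a : hmul (hone A) a = a.
Proof. by apply: homog_eq; rewrite /= ?mul1r ?add0r. Qed.

Lemma hmulr1 a : hmul a (hone A) = a.
Proof. by apply: homog_eq; rewrite /= ?mulr1 ?addr0. Qed.

Definition pairing phi (C : chain A) : k := \sum_(t <- C) (-1) ^ t.1 * phi t.2.

Lemma eq_big_all (T : Type) (P : pred T) (s : seq T) (f g : T -> k) :
  all P s -> (forall t, P t -> f t = g t) ->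
  \sum_(t <- s) f t = \sum_(t <- s) g t.
Proof.
move=> Ps E; elim: s Ps => [|t s IH] /=; first by rewrite !big_nil.
by case/andP=> /E Et /IH Es; rewrite !big_cons Et Es.
Qed.

Lemma sum_iota n (f : nat -> k) :
  \sum_(i <- iota 0 n) f i = \sum_(i < n) f i.
Proof. by rewrite -[in LHS](subn0 n) -/(index_iota 0 n) big_mkord. Qed.

Definition raises_degree (n : int) F : Prop :=
  forall x, all (fun t => hgen_deg t.2 == hgen_deg x + n) (F x).

(** All terms of [F x] have the same degree, so the sign of the transpose is a common factor. *)
Lemma transposeE n F phi x : raises_degree n F ->
  transpose F phi x = (-1) ^ (hgen_deg x + n) * pairing phi (F x).
Proof.
move=> dF; rewrite /transpose /pairing mulr_sumr; apply: (eq_big_all (dF x)).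
by move=> t /eqP ->; rewrite mulrCA.
Qed.

Lemma hgen_degE a l : hgen_deg (a, l) = 1 + sdeg (a :: l).
Proof. by rewrite /hgen_deg sdeg_cons /=; ring. Qed.

Lemma cat_take_drop2 i l : (i.+1 < size l)%N ->
  take i l ++ [:: nth (hone A) l i, nth (hone A) l i.+1 & drop i.+2 l] = l.
Proof.
by move=> lt_il; rewrite -!drop_nth ?cat_take_drop // (ltnW lt_il).
Qed.

Lemma hoch_d0_degree : raises_degree 1 (@hoch_d0 k A).
Proof.
case=> a0 l; rewrite /hoch_d0 /= !hgen_degE !sdeg_cons /=.
apply/andP; split; first by apply/eqP; ring.
rewrite all_map; apply/allP => i; rewrite mem_iota /= => lt_il; apply/eqP.
rewrite hgen_degE -[in RHS](cat_take_drop i l) (@drop_nth _ (hone A) i) //.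
rewrite !(sdeg_cons, sdeg_cat) /=; ring.
Qed.

Lemma hoch_d1_degree : raises_degree 1 (@hoch_d1 k A).
Proof.
case=> a0 [//|a1 l]; rewrite /hoch_d1 /= all_rcons /= all_map.
rewrite !hgen_degE !sdeg_cons /=.
apply/and3P; split; first by apply/eqP; ring.
  apply/eqP.
  have : sdeg (a1 :: l) = sdeg (belast a1 l) + (hdeg (last a1 l) - 1).
    by rewrite lastI -cats1 sdeg_cat sdeg_cons sdeg_nil addr0.
  by rewrite sdeg_cons => ->; ring.
apply/allP => i; rewrite mem_iota /= => lt_il; apply/eqP.
rewrite hgen_degE -sdeg_cons -[in RHS](@cat_take_drop2 i (a1 :: l)) //.
rewrite !(sdeg_cons, sdeg_cat); set u := take _ _; set v := drop _ _.
by rewrite [hdeg (hmul _ _)]/=; ring.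
Qed.

Lemma hoch_d_degree : raises_degree 1 (@hoch_d k A).
Proof. by move=> x; rewrite /hoch_d all_cat hoch_d0_degree hoch_d1_degree. Qed.

Lemma connes_B_degree : raises_degree (-1) (@connes_B k A).
Proof.
case=> a0 l; rewrite /connes_B all_map; apply/allP => i _ /=; apply/eqP.
rewrite hgen_degE sdeg_cons sdeg_rot hgen_degE /=; ring.
Qed.

Lemma mul_head_nth (G : word -> k) i m : (i.+1 < size m)%N ->
  iter i rotate (mul_head (iter ((size m).-1 - i) rotate G)) m
  = (-1) ^ sdeg (take i.+1 m) * G (take i m ++
      hmul (nth (hone A) m i) (nth (hone A) m i.+1) :: drop i.+2 m).
Proof.
move=> lt_im.
have := @mul_head_at k A G (take i m) (nth (hone A) m i) (nth (hone A) m i.+1)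
  (drop i.+2 m).
rewrite cat_take_drop2 // size_takel 1?ltnW 1?ltnW // size_drop.
have -> : (size m - i.+2).+1 = ((size m).-1 - i)%N by lia.
move=> ->; rewrite (take_nth (hone A)) 1?ltnW // -cats1 sdeg_cat.
by rewrite sdeg_cons sdeg_nil addr0.
Qed.

Lemma d_head_nth (G : word -> k) i m : (i < size m)%N ->
  iter i rotate (d_head (iter (size m - i) rotate G)) m
  = (-1) ^ sdeg (take i m) *
    G (take i m ++ hd (nth (hone A) m i) :: drop i.+1 m).
Proof.
move=> lt_im.
have := @d_head_at k A G (take i m) (nth (hone A) m i) (drop i.+1 m).
by rewrite -drop_nth // cat_take_drop size_takel 1?ltnW // size_drop subnSK.
Qed.

Lemma iter_rotate_rcons (G : word -> k) m a :
  iter (size m) rotate G (rcons m a)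
  = (-1) ^ (sdeg m * (hdeg a - 1)) * G (a :: m).
Proof.
by rewrite -cats1 iter_rotate_cat sdeg_cons sdeg_nil addr0.
Qed.

(** The value 0 at the empty word agrees with the empty cyclic sum, so that cyclic sums are
    unchanged by this extension. *)
Definition of_word phi : word -> k :=
  fun m => if m is a :: r then phi (a, r) else 0.

Lemma pairing_connes_B phi a0 l :
  pairing phi (connes_B (a0, l))
  = cyclic_sum (fun m => phi (hone A, m)) (a0 :: l).
Proof.
rewrite /pairing /connes_B big_map -sum_iter_rotateS.
rewrite [in LHS](iotaDl 1 0 (size _)) big_map sum_iota.
by apply: eq_bigr => i _; rewrite iter_rotateE.
Qed.

Lemma pairing_hoch_d0 phi a0 l :
  pairing phi (hoch_d0 (a0, l)) = \sum_(j < (size l).+1)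
    iter j rotate (d_head (iter ((size l).+1 - j)
       rotate (of_word phi))) (a0 :: l).
Proof.
under eq_bigr => j _ do
  rewrite (@d_head_nth (of_word phi) j (a0 :: l) (ltn_ord j)).
rewrite big_ord_recl /pairing /hoch_d0 big_cons; congr (_ + _).
  by rewrite take0 sdeg_nil drop1.
rewrite big_map sum_iota; apply: eq_bigr => i _.
rewrite lift0 hgen_degE /= addrA.
by rewrite (@sign_eq k 1 _ (sdeg (a0 :: take i l))) 1?addrC.
Qed.

(** The last index is the wrap-around product an a0, which completes a full period of rotations. The
    global sign comes from |a0| = 1 + (|a0| - 1). *)
Lemma pairing_hoch_d1 phi a0 l :
  pairing phi (hoch_d1 (a0, l)) = - \sum_(j < (size l).+1)
    iter j rotate (mul_head (iter (size l - j)
       rotate (of_word phi))) (a0 :: l).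
Proof.
rewrite big_ord_recr /= subnn.
have lt (i : 'I_(size l)) : (i.+1 < size (a0 :: l))%N by rewrite ltnS.
under eq_bigr => j _ do rewrite (mul_head_nth (of_word phi) (lt j)).
rewrite /pairing; case: l lt => [|a1 l] _.
  by rewrite /hoch_d1 big_nil big_ord0 addr0 oppr0.
rewrite /hoch_d1 big_cons -cats1 big_cat big_seq1 big_map sum_iota.
rewrite big_ord_recl /= !opprD -addrA; congr (_ + (_ + _)).
- by rewrite sdeg_cons sdeg_nil addr0 drop0 -mulNr -signS addrC subrK.
- apply: (canRL (@opprK _)); rewrite -sumrN; apply: eq_bigr => i _.
  by rewrite -mulNr hgen_degE signS opprK.
- have E : a0 :: a1 :: l = rcons (a0 :: belast a1 l) (last a1 l).
    by rewrite rcons_cons -lastI.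
  have := iter_rotate_rcons (mul_head (of_word phi)) (a0 :: belast a1 l)
    (last a1 l).
  rewrite -E [size (_ :: _)]/= size_belast => /= ->.
  rewrite mulrA -mulNr -signD -signS; congr (_ * _).
  rewrite hgen_degE; apply: (@sign_eq k (- 0)); ring.
Qed.

(** The outer products 1 a1 and an 1 give phi - T^-1 phi, as [(size m).-1] rotations undo one. The
    products inside the bracket give b', whose index stops one short of a full period. *)
Lemma pairing_hoch_d1_hone phi m : (0 < size m)%N ->
  pairing phi (hoch_d1 (hone A, m))
  = (of_word phi m - iter (size m).-1 rotate (of_word phi) m)
    + \sum_(j < (size m).-1) iter j rotate (mul_head
       (iter ((size m).-1 - j) rotate (fun p => phi (hone A, p)))) m.
Proof.
case: m => // a1 l _; rewrite [size _]/= [_.-1]/=.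
have lt (i : 'I_(size l)) : (i.+1 < size (a1 :: l))%N by rewrite ltnS.
under eq_bigr => j _ do rewrite (mul_head_nth _ (lt j)).
rewrite /pairing /hoch_d1 big_cons -cats1 big_cat big_seq1 big_map sum_iota.
rewrite hmul1 expr0z mul1r -addrA; congr (_ + _); rewrite addrC; congr (_ + _).
  apply: eq_bigr => i _.
  by rewrite hgen_degE sdeg_cons /= sub0r addrA addrN add0r.
have := iter_rotate_rcons (of_word phi) (belast a1 l) (last a1 l).
rewrite -lastI size_belast => ->.
by rewrite hmulr1 signS mulNr hgen_degE sdeg_cons /= sub0r addrA addrN add0r.
Qed.

Lemma pairing_hoch_d0_hone phi m : is_cochain phi ->
  pairing phi (hoch_d0 (hone A, m))
  = - \sum_(j < size m) iter j rotate (d_head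
       (iter (size m - j) rotate (fun p => phi (hone A, p)))) m.
Proof.
case=> phi_lin _ _ _.
under eq_bigr => j _ do rewrite d_head_nth //.
rewrite /pairing /hoch_d0 big_cons big_map sum_iota.
(* Since d 1 = 0 is the combination 1 * 0 + 0 in its degree, linearity gives t = t + t for this
   value t. *)
have -> : phi (hd (hone A), m) = 0.
  have /(phi_lin _ _ _ _ m) :
      lin_comb 1 (hd (hone A)) (hd (hone A)) (hd (hone A)).
    by split; rewrite //= dg_d1 scaler0 addr0.
  by rewrite mul1r => /esym/(canRL (addKr _)); rewrite addNr.
rewrite mulr0 add0r -sumrN; apply: eq_bigr => i _.
by rewrite -mulNr -signS hgen_degE sdeg_cons /= sub0r !addrA addrK.
Qed.

(** [lin_comb] forces equal degrees, so the rotation signs of the three words agree. *)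
Lemma rotate_linear (G : word -> k) c a b e : lin_comb c a b e ->
  (forall l r, G (l ++ e :: r) = c * G (l ++ a :: r) + G (l ++ b :: r)) ->
  forall l r, rotate G (l ++ e :: r)
    = c * rotate G (l ++ a :: r) + rotate G (l ++ b :: r).
Proof.
case=> da db _ G_lin [|x l] r; rewrite /rotate /= ?take0 ?drop0 !rot1_cons.
  rewrite -!cats1 G_lin !sdeg_cons sdeg_nil da db.
  by rewrite mulrDr mulrCA.
rewrite !rcons_cat !rcons_cons G_lin !sdeg_cons !sdeg_cat !sdeg_cons da db.
by rewrite mulrDr mulrCA.
Qed.

Lemma rotate_eq0 (G : word -> k) e :
  (forall l r, G (l ++ e :: r) = 0) ->
  forall l r, rotate G (l ++ e :: r) = 0.
Proof.
move=> G0 [|x l] r; rewrite /rotate /= rot1_cons.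
  by rewrite -cats1 G0 mulr0.
by rewrite rcons_cat rcons_cons G0 mulr0.
Qed.

Lemma cyclic_sum_linear (G : word -> k) c a b e : lin_comb c a b e ->
  (forall l r, G (l ++ e :: r) = c * G (l ++ a :: r) + G (l ++ b :: r)) ->
  forall l r, cyclic_sum G (l ++ e :: r)
    = c * cyclic_sum G (l ++ a :: r) + cyclic_sum G (l ++ b :: r).
Proof.
move=> abe G_lin l r; rewrite /cyclic_sum !size_cat /= mulr_sumr -big_split.
apply: eq_bigr => -[i /= _] _.
by elim: i l r => [|i IH] //= l r; apply: rotate_linear.
Qed.

Lemma cyclic_sum_eq0 (G : word -> k) e :
  (forall l r, G (l ++ e :: r) = 0) ->
  forall l r, cyclic_sum G (l ++ e :: r) = 0.
Proof.
move=> G0 l r; rewrite /cyclic_sum big1 // => -[i /= _] _.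
by elim: i l r => [|i IH] //= l r; apply: rotate_eq0.
Qed.

Lemma connes_BvE phi a0 l :
  connes_Bv phi (a0, l) = (-1) ^ sdeg (a0 :: l) *
    cyclic_sum (fun m => phi (hone A, m)) (a0 :: l).
Proof.
rewrite /connes_Bv (transposeE _ _ connes_B_degree) pairing_connes_B hgen_degE.
by rewrite addrAC addrN add0r.
Qed.

Lemma transpose_supp n F phi (S : seq int) : raises_degree n F ->
  (forall x, phi x != 0 -> hgen_deg x \in S) ->
  forall x, transpose F phi x != 0 -> hgen_deg x + n \in S.
Proof.
move=> dF phiS x; apply: contra_neqT => xS; rewrite /transpose.
rewrite (eq_big_all (g := fun=> 0) (dF x)) ?big1 // => t /eqP Et.
suff -> : phi t.2 = 0 by rewrite !mulr0.
by apply/eqP; apply: contraNT xS => /phiS; rewrite Et.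
Qed.

Lemma connes_Bv_cochain phi :
  phi \in @cochain k A -> connes_Bv phi \in @cochain k A.
Proof.
move=> /asboolP[_ phi_lin phi0 [S phiS]]; apply/asboolP; split.
- move=> c a b e l abe; rewrite !connes_BvE.
  have := cyclic_sum_linear (G := fun m => phi (hone A, m)) abe
    (fun p q => phi_lin _ _ _ _ (hone A) p q abe) [::] l.
  case: abe => da db _ /= ->; rewrite !sdeg_cons da db.
  by rewrite mulrDr mulrCA.
- move=> c a b e a0 l r abe; rewrite !connes_BvE.
  have := cyclic_sum_linear (G := fun m => phi (hone A, m)) abe
    (fun p q => phi_lin _ _ _ _ (hone A) p q abe) (a0 :: l) r.
  case: abe => da db _ /= ->; rewrite -!cat_cons !sdeg_cat !sdeg_cons da db.
  by rewrite mulrDr mulrCA.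
- move=> c e a0 l r Ee; rewrite connes_BvE.
  rewrite -cat_cons cyclic_sum_eq0 ?mulr0 // => p q.
  exact: phi0 Ee.
exists [seq n + 1 | n <- S] => x /(transpose_supp connes_B_degree phiS) xS.
by apply/mapP; exists (hgen_deg x - 1); rewrite ?subrK.
Qed.

(** The 1 put in front by the outer operator is rotated into the brackets by the inner one, where a
    normalized cochain vanishes. *)
Lemma connes_Bv_Bv phi :
  phi \in @cochain k A -> connes_Bv (connes_Bv phi) = 0.
Proof.
move=> /asboolP[_ _ phi0 _]; apply/funext => -[a0 l].
rewrite connes_BvE /cyclic_sum big1 ?mulr0 // => i _.
rewrite iter_rotateE 1?ltnW // connes_BvE.
rewrite -[hone A :: _]/([::] ++ _) cyclic_sum_eq0 ?mulr0 // => p q.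
by apply: (phi0 1); rewrite scale1r.
Qed.

Lemma pairing_sign n F phi x : raises_degree n F ->
  pairing (fun y => (-1) ^ hgen_deg y * phi y) (F x)
  = (-1) ^ (hgen_deg x + n) * pairing phi (F x).
Proof.
move=> dF; rewrite /pairing mulr_sumr; apply: (eq_big_all (dF x)).
by move=> t /eqP ->; rewrite mulrCA.
Qed.

Lemma of_word_cyclic_sum (G : word -> k) :
  of_word (fun y => cyclic_sum G (y.1 :: y.2)) = cyclic_sum G.
Proof.
by apply/funext => -[|a l] //; rewrite /cyclic_sum big_ord0.
Qed.

(** This is the anticommutation of d^v and B^v stripped of transposition signs: N f N appears once
    from each side, with opposite signs, for f the differential and for f the product. *)
Lemma pairing_hoch_d_cyclic_sum phi x : is_cochain phi ->
  pairing (fun y => cyclic_sum (fun m => phi (hone A, m)) (y.1 :: y.2))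
    (hoch_d x)
  + cyclic_sum (fun m => pairing phi (hoch_d (hone A, m))) (x.1 :: x.2) = 0.
Proof.
case: x => a0 l phiC; set G := fun m => phi (hone A, m).
have pairing_cat psi y : pairing psi (hoch_d y)
    = pairing psi (hoch_d0 y) + pairing psi (hoch_d1 y).
  by rewrite /pairing big_cat.
rewrite pairing_cat pairing_hoch_d0 pairing_hoch_d1 of_word_cyclic_sum.
under eq_bigr do rewrite iter_rotate_cyclic_sum.
under [X in _ - X]eq_bigr do rewrite iter_rotate_cyclic_sum.
have -> : cyclic_sum (fun m => pairing phi (hoch_d (hone A, m))) (a0 :: l)
  = cyclic_sum (fun m =>
      (of_word phi m + -1 * iter (size l) rotate (of_word phi) m)
      + (\sum_(j < (size (a0 :: l)).-1) iter j rotate (mul_head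
         (iter ((size (a0 :: l)).-1 - j) rotate G)) m
      + -1 * \sum_(j < size (a0 :: l)) iter j rotate (d_head
         (iter (size (a0 :: l) - j) rotate G)) m)) (a0 :: l).
  apply: eq_cyclic_sum => m sz; rewrite pairing_cat pairing_hoch_d0_hone //.
  by rewrite pairing_hoch_d1_hone sz // !mulN1r addrC addrA.
rewrite !cyclic_sumD !cyclic_sum_scaler cyclic_sum_mul_head cyclic_sum_d_head.
(* N phi - N T^(size l) phi = 0 removes the outer products with 1. *)
rewrite cyclic_sum_iter_rotate !mulN1r addrN add0r.
rewrite -![\sum_(_ < _) _]/(cyclic_sum _ (a0 :: l)).
by rewrite addrA subrK addrN.
Qed.

Lemma hoch_dv_connes_Bv phi : phi \in @cochain k A ->
  hoch_dv (connes_Bv phi) = - connes_Bv (hoch_dv phi).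
Proof.
move=> /asboolP phiC; apply/funext => -[a0 l].
rewrite -[RHS]/(- (connes_Bv (hoch_dv phi) (a0, l))).
(* In this form the sign of B^v phi, carried through [hoch_d], cancels the transposition sign of
   d^v. *)
have -> : connes_Bv phi = fun y => (-1) ^ hgen_deg y *
    (- cyclic_sum (fun m => phi (hone A, m)) (y.1 :: y.2)).
  apply/funext => -[b m]; rewrite connes_BvE hgen_degE signS.
  by rewrite mulrN mulNr opprK.
rewrite connes_BvE /hoch_dv (transposeE _ _ hoch_d_degree).
rewrite (pairing_sign _ _ hoch_d_degree) mulrA sign_sqr mul1r.
have -> : (fun m => transpose (@hoch_d k A) phi (hone A, m)) = fun m =>
    (-1) ^ sdeg m * (-1 * pairing phi (hoch_d (hone A, m))).
  apply/funext => m; rewrite (transposeE _ _ hoch_d_degree) hgen_degE.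
  rewrite sdeg_cons sub0r addNKr addrC signS mulN1r mulrN mulNr //.
rewrite cyclic_sum_sign cyclic_sum_scaler mulN1r mulrA sign_sqr mul1r opprK.
have := pairing_hoch_d_cyclic_sum (a0, l) phiC.
move=> /(canRL (addKr _)); rewrite addr0 => ->.
by rewrite /pairing -sumrN; apply: eq_bigr => t _; rewrite mulrN.
Qed.

End Hochschild.

(** * Cohomology and connecting maps *)

Lemma submodClosedB (k : fieldType) (V : lmodType k) (U : submodClosed V) :
  {in U &, forall u v, u - v \in U}.
Proof.
exact: (GRing.submod_closedB (GRing.submodClosedP U)).2.
Qed.

Section CohomologyClasses.
Variables (k : fieldType) (X : complex k).
Implicit Types (z : ambient X) (x : cohomology X).

Lemma coh_class_eq z z' : z \in cocycle X -> z' \in cocycle X ->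
  coh_class z = coh_class z' <->
  exists2 y, y \in space X & z - z' = diff X y.
Proof.
move=> zC zC'; rewrite /coh_class.
split=> [/eqP | [y Xy E]]; last apply/eqP.
  rewrite quot_piE => /asboolP[y Xy]; rewrite raddfB /= !insubdK //.
  by exists y.
by rewrite quot_piE; apply/asboolP; exists y => //; rewrite raddfB /= !insubdK.
Qed.

Lemma coh_classP x : exists2 z, z \in cocycle X & x = coh_class z.
Proof.
have [z ->] := quot_piP x; exists (val z); first exact: valP.
by rewrite /coh_class valKd.
Qed.

Lemma coh_class_linear (c : k) z z' : z \in cocycle X -> z' \in cocycle X ->
  coh_class (c *: z + z') = c *: coh_class z + coh_class z'.
Proof.
move=> zC zC'; rewrite /coh_class.
have -> : insubd (0 : cocycles X) (c *: z + z')
    = c *: insubd (0 : cocycles X) z + insubd (0 : cocycles X) z'.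
  by apply: val_inj; rewrite linearP /= !insubdK // rpredD ?rpredZ.
by rewrite quot_piD -pi_quot_scale.
Qed.

Lemma coh_class0 : coh_class (0 : ambient X) = 0.
Proof.
have := @coh_class_linear (-1) 0 0 (rpred0 _) (rpred0 _).
by rewrite scaler0 addr0 scaleN1r addNr.
Qed.

Lemma coh_class_eq0 z : z \in cocycle X ->
  coh_class z = 0 <-> exists2 y, y \in space X & z = diff X y.
Proof.
by move=> zC; rewrite -coh_class0 coh_class_eq ?rpred0 // subr0.
Qed.

Lemma coh_class_sum (I : Type) (s : seq I) (f : I -> ambient X) :
  (forall i, f i \in cocycle X) ->
  coh_class (\sum_(i <- s) f i) = \sum_(i <- s) coh_class (f i).
Proof.
move=> fC; elim: s => [|i s IH]; first by rewrite !big_nil coh_class0.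
rewrite !big_cons -IH -[in LHS](scale1r (f i)).
by rewrite coh_class_linear ?scale1r // rpred_sum.
Qed.

End CohomologyClasses.

(** * Induced and connecting maps computed on cocycles *)

Section InducedMaps.
Variables (k : fieldType) (X Y Z : complex k).

Lemma linear_on_classes (F : cohomology X -> cohomology Y)
    (f : {linear ambient X -> ambient Y}) :
  (forall z, z \in cocycle X -> f z \in cocycle Y) ->
  (forall z, z \in cocycle X -> F (coh_class z) = coh_class (f z)) -> linear F.
Proof.
move=> fZ FE c x y; have [z zC ->] := coh_classP x.
have [z' zC' ->] := coh_classP y.
rewrite -coh_class_linear // !FE ?rpredD ?rpredZ // linearP.
by rewrite coh_class_linear ?fZ.
Qed.

Section CohMap.
Variable f : {linear ambient X -> ambient Y}.
Hypothesis f_cocycle : forall z, z \in cocycle X -> f z \in cocycle Y.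
Hypothesis f_exact : forall y, y \in space X -> diff X y \in cocycle X ->
  exists2 y', y' \in space Y & f (diff X y) = diff Y y'.

Lemma coh_mapE z : z \in cocycle X ->
  coh_map f (coh_class z) = coh_class (f z).
Proof.
move=> zC; rewrite /coh_map.
case: xgetP => [y _ [z' [zC' E ->]]|/(_ (coh_class (f z)))].
  apply/coh_class_eq; rewrite ?f_cocycle //.
  have /esym/(coh_class_eq zC' zC)[y' Xy' E'] := E.
  rewrite -raddfB E'; apply: f_exact => //.
  by rewrite -E' rpredB.
by case; exists z.
Qed.

End CohMap.

Section Connecting.
Variables (f : {linear ambient X -> ambient Y}).
Variables (g : {linear ambient Y -> ambient Z}).
Variables (lift : {linear ambient Z -> ambient Y}).
Variables (delta : {linear ambient Z -> ambient X}).
Hypothesis lift_space : forall z, z \in cocycle Z -> lift z \in space Y.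
Hypothesis liftK : forall z, z \in cocycle Z -> g (lift z) = z.
Hypothesis delta_cocycle : forall z, z \in cocycle Z -> delta z \in cocycle X.
Hypothesis f_delta : forall z, z \in cocycle Z -> f (delta z) = diff Y (lift z).
Hypothesis connecting_exact : forall u v y,
  v \in space Y -> y \in space Z -> g v \in cocycle Z -> u \in cocycle X ->
  g v = diff Z y -> f u = diff Y v -> exists2 w, w \in space X & u = diff X w.

(** An arbitrary choice of lift and preimage differs from the canonical one by a pair over a
    coboundary, so linearity reduces independence of choices to [connecting_exact]. *)
Lemma connectingE z : z \in cocycle Z ->
  connecting f g (coh_class z) = coh_class (delta z).
Proof.
move=> zC; rewrite /connecting.
case: xgetP => [x _ [u [v [[Yv gvC E] [uC fu ->]]]]|]; last first.
  move/(_ (coh_class (delta z))); case; exists (delta z), (lift z).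
  by rewrite lift_space ?liftK ?delta_cocycle ?f_delta.
apply/coh_class_eq; rewrite ?delta_cocycle //.
have /esym/(coh_class_eq gvC zC)[y Zy E'] := E.
apply: (@connecting_exact _ (v - lift z) y) => //.
- by apply: submodClosedB => //; exact: lift_space.
- by rewrite linearB /= liftK ?rpredB.
- by rewrite rpredB ?delta_cocycle.
- by rewrite linearB /= liftK.
- by rewrite !linearB /= fu f_delta.
Qed.

End Connecting.
End InducedMaps.

(** * The grading induced on cohomology by degree projections *)

Section GradedCohomology.
Variables (k : fieldType) (X : complex k).
Variable proj : int -> {linear ambient X -> ambient X}.
Hypothesis proj_space : forall n v, v \in space X -> proj n v \in space X.
Hypothesis proj_homogeneous : forall n v, homogeneous n (proj n v).
Hypothesis projE : forall m n v, homogeneous n v ->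
  proj m v = if m == n then v else 0.
Hypothesis proj_diff : forall n v, proj n (diff X v) = diff X (proj (n + 1) v).
Hypothesis proj_finite : forall v, v \in space X ->
  exists s : seq int, v = \sum_(n <- s) proj n v.

Lemma proj_cocycle n z : z \in cocycle X -> proj n z \in cocycle X.
Proof.
rewrite !inE => /andP[Xz /eqP dz]; rewrite proj_space //=.
by rewrite -[n](subrK 1) -proj_diff dz linear0.
Qed.

Lemma graded_cohomology (h h' : int -> int) :
  cancel h h' -> cancel h' h ->
  graded_space (fun n => @coh_homogeneous k X (h n)).
Proof.
move=> hK hK'; split.
- move=> n; split.
    exists 0; rewrite rpred0 coh_class0; split=> //.
    by rewrite -(linear0 (proj (h n))).
  move=> c _ _ [z [zC hz ->]] [z' [zC' hz' ->]]; exists (c *: z + z').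
  rewrite rpredD ?rpredZ // coh_class_linear //; split=> //.
  (* Closure of [homogeneous] under combinations is read off from the projection, which fixes both
     summands. *)
  have <- : proj (h n) (c *: z + z') = c *: z + z'.
    by rewrite linearP (projE _ hz) (projE _ hz') eqxx.
  exact: proj_homogeneous.
- move=> x; have [z zC ->] := coh_classP x.
  have /proj_finite[s Es] : z \in space X by move: zC; rewrite inE => /andP[].
  exists [seq h' n | n <- s], (fun n => coh_class (proj (h n) z)); split.
    by move=> n; exists (proj (h n) z); rewrite proj_cocycle.
  rewrite big_map [in LHS]Es coh_class_sum => [|n]; last exact: proj_cocycle.
  by apply: eq_bigr => n _; rewrite hK'.
move=> s f us fh.
have /boolp.choice[z zP] : forall n, exists z,
    [/\ z \in cocycle X, homogeneous (h n) z & f n = coh_class z] by [].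
under eq_bigr => n _ do have [_ _ ->] := zP n.
rewrite -coh_class_sum => [|n]; last by have [] := zP n.
have zC : \sum_(n <- s) z n \in cocycle X.
  by rewrite rpred_sum // => n _; have [] := zP n.
move=> /(coh_class_eq0 zC)[y Xy Ey] m ms.
have [zmC hm ->] := zP m; apply/(coh_class_eq0 zmC).
(* The differential lowers degrees by one, so this component of [y] bounds the degree [h m] part of
   the sum, which is [z m]. *)
exists (proj (h m + 1) y); first exact: proj_space.
rewrite -proj_diff -Ey linear_sum (bigD1_seq m) //= big1 => [|n nm].
  by rewrite addr0 (projE _ hm) eqxx.
have [_ hn _] := zP n; rewrite (projE _ hn); case: eqP => // /(can_inj hK) E.
by rewrite E eqxx in nm.
Qed.

End GradedCohomology.

(** * The bracket *)

Section LieFromBV.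
Variables (k : fieldType) (L H : lmodType k).
Variables (grL : int -> set L) (grH : int -> set H).
Variables (cup : H -> H -> H) (Delta : H -> H).
Variables (b : {linear L -> H}) (i : {linear H -> L}) (sign : {linear L -> L}).
Variable e : int.
Hypothesis BV : BV_algebra grH cup Delta.
Hypothesis grL_graded : graded_space grL.
Hypothesis b_degree : forall n x, grL n x -> grH (n + 1) (b x).
Hypothesis i_degree : forall n a, grH n a -> grL n (i a).
Hypothesis bi : forall a, b (i a) = Delta a.
Hypothesis ib : forall x, i (b x) = 0.
Hypothesis signE : forall n x, grL n x -> sign x = (-1) ^ (n + e) *: x.

(* [sign] extends x |-> (-1)^|x| x, up to a global sign, to inhomogeneous x,
   which the bracket has to be defined on as well. *)
Lemma BV_bracket : exists br : L -> L -> L,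
  (forall (m : int) x y, grL m x ->
     br x y = (-1) ^ m *: i (cup (b x) (b y))) /\
  graded_lie_algebra grL br.
Proof.
have [[grH_graded [cupDl cupDr] cup_degree] [cupC _] _ _ BV7] := BV.
have cupZl c x y : cup (c *: x) y = c *: cup x y.
  have cup0 : cup 0 y = 0.
    have := cupDl (-1) 0 0 y.
    by rewrite scaler0 addr0 scaleN1r addNr.
  by have := cupDl c x 0 y; rewrite !addr0 cup0 addr0.
have cupZr c x y : cup y (c *: x) = c *: cup y x.
  have cup0 : cup y 0 = 0.
    have := cupDr (-1) 0 0 y.
    by rewrite scaler0 addr0 scaleN1r addNr.
  by have := cupDr c x 0 y; rewrite !addr0 cup0 addr0.
have cup0l y : cup 0 y = 0 by rewrite -(scale0r (0 : H)) cupZl !scale0r.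
have cup0r y : cup y 0 = 0 by rewrite -(scale0r (0 : H)) cupZr !scale0r.
have iDelta a : i (Delta a) = 0 by rewrite -bi ib.
have Deltab x : Delta (b x) = 0 by rewrite -bi ib linear0.
pose br x y := (-1) ^ e *: i (cup (b (sign x)) (b y)).
have brE m x y : grL m x -> br x y = (-1) ^ m *: i (cup (b x) (b y)).
  move=> /signE; rewrite /br => ->.
  rewrite linearZ cupZl linearZ scalerA -signD.
  by congr (_ *: _); apply: (@sign_eq k e); ring.
have br_degree m n x y : grL m x -> grL n y -> grL (m + n + 2 * 1) (br x y).
  move=> hx hy; rewrite (brE m) //.
  have [/(_ (m + n + 2 * 1))[gr0 grD] _ _] := grL_graded.
  rewrite -[_ *: _]addr0; apply: grD => //; apply: i_degree.
  have -> : m + n + 2 * 1 = (m + 1) + (n + 1) by ring.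
  by apply: cup_degree; exact: b_degree.
exists br; split; first exact: brE.
split.
- split=> //; split=> c x y z; rewrite /br !linearP /=.
    by rewrite cupDl linearP scalerDr !scalerA mulrC.
  by rewrite cupDr linearP scalerDr !scalerA mulrC.
- by exists 1.
- move=> m n x y hx hy; rewrite (brE m) // (brE n) //.
  rewrite (cupC _ _ _ _ (b_degree hx) (b_degree hy)) linearZ /=.
  rewrite !scalerA -!signD.
  rewrite -scaleNr -signS; congr (_ *: _); apply: (@sign_eq k m); ring.
move=> m n p x y z hx hy hz.
have hxy := br_degree _ _ _ _ hx hy.
rewrite (brE _ _ (br y z) hx) (brE _ _ z hxy) (brE _ _ (br x z) hy).
rewrite (brE _ _ z hy) (brE _ _ y hx) (brE _ _ z hx).
rewrite !(linearZ, cupZl, cupZr) /= !bi !(linearZ, cupZl, cupZr) /=.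
rewrite !scalerA -!signD.
have := congr1 i (BV7 _ _ _ _ _ _ (b_degree hx) (b_degree hy) (b_degree hz)).
rewrite iDelta !Deltab !(cup0l, cup0r) !linearB !linearD !linearZ /=.
rewrite !linear0 !addr0.
set u := i (cup (Delta _) _); set v := i (cup _ _); set w := i (cup _ _).
(* The three surviving BV terms carry the signs 1, (-1)^(m+1) and (-1)^(m(n+1)), as [b] shifts
   degrees by one. The factor (-1)^n turns them into the signs of the Jacobi identity. *)
move=> /esym/(congr1 ( *:%R ((-1) ^ n))).
rewrite scaler0 !scalerDr !scalerA -!signD addrAC.
rewrite (@sign_eq k 0 (n + (m + 1)) (1 + (m + n))); last by ring.
rewrite signS scaleNr => /subr0_eq E; symmetry.
rewrite -E; congr (_ *: _ + _ *: _).
  by apply: (@sign_eq k (m + 1)); ring.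
by apply: (@sign_eq k 0); ring.
Qed.

End LieFromBV.

(** * Degrees of cochains *)

Section Components.
Variables (k : fieldType) (A : dgAlgebra k).
Implicit Types (phi : cofun A) (psi : series A) (F : hgen A -> chain A).

(** Both the projection onto one degree and the sign operator are of this form, so their
    compatibility with d^v and B^v is proved once. *)
Definition degree_scale (w : int -> k) phi : cofun A :=
  fun x => w (hgen_deg x) * phi x.

Lemma degree_scale_linear w : linear (degree_scale w).
Proof.
move=> c f g; apply/funext => x.
rewrite [RHS]/GRing.add /= [in RHS]/GRing.scale /= /degree_scale.
by rewrite [(_ + _) x]/GRing.add /= [(_ *: _) x]/GRing.scale /= mulrDr mulrCA.
Qed.
HB.instance Definition _ w := GRing.isLinear.Build k (cofun A) (cofun A) _
  (degree_scale w) (degree_scale_linear w).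

Definition component (n : int) : cofun A -> cofun A :=
  degree_scale (fun m => (m == n)%:R).
HB.instance Definition _ n := GRing.Linear.on (component n).

Definition sign_degree : cofun A -> cofun A := degree_scale (fun m => (-1) ^ m).
HB.instance Definition _ := GRing.Linear.on sign_degree.

Lemma degree_scaleE w n phi : hoch_homogeneous n phi ->
  degree_scale w phi = w n *: phi.
Proof.
move=> hphi; apply/funext => x; rewrite /degree_scale [RHS]/GRing.scale /=.
by have [->|/hphi ->//] := eqVneq (phi x) 0; rewrite mulr0 scaler0.
Qed.

Lemma degree_scale_cochain w phi :
  phi \in @cochain k A -> degree_scale w phi \in @cochain k A.
Proof.
move=> /asboolP[phi_lin0 phi_lin phi0 [S phiS]]; apply/asboolP; split.
- move=> c a b e l abe; rewrite /degree_scale (phi_lin0 _ _ _ _ _ abe).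
  rewrite !hgen_degE !sdeg_cons.
  by case: abe => -> -> _; rewrite mulrDr mulrCA.
- move=> c a b e a0 l r abe; rewrite /degree_scale (phi_lin _ _ _ _ _ _ _ abe).
  rewrite !hgen_degE -!cat_cons !sdeg_cat !sdeg_cons.
  by case: abe => -> -> _; rewrite mulrDr mulrCA.
- by move=> c e a0 l r Ee; rewrite /degree_scale (phi0 _ _ _ _ _ Ee) mulr0.
by exists S => x; rewrite mulf_eq0 negb_or => /andP[_ /phiS].
Qed.

Lemma degree_scale_transpose e F (w w' : int -> k) phi :
  raises_degree e F -> (forall n, w n = w' (n + e)) ->
  degree_scale w (transpose F phi) = transpose F (degree_scale w' phi).
Proof.
move=> dF Ew; apply/funext => x; rewrite /degree_scale !(transposeE _ _ dF) Ew.
rewrite mulrCA; congr (_ * _); rewrite /pairing mulr_sumr.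
by apply: (eq_big_all (dF x)) => t /eqP ->; rewrite mulrCA.
Qed.

Lemma component_transpose e F n phi : raises_degree e F ->
  component n (transpose F phi) = transpose F (component (n + e) phi).
Proof.
move=> dF; apply: degree_scale_transpose dF _ => m.
by rewrite (inj_eq (addIr e)).
Qed.

Lemma sign_degree_transpose F phi n : n = 1 \/ n = -1 -> raises_degree n F ->
  sign_degree (transpose F phi) = - transpose F (sign_degree phi).
Proof.
move=> n1 dF; rewrite /sign_degree.
rewrite (degree_scale_transpose (w' := fun m => - (-1) ^ m) _ dF).
  rewrite -linearN; congr (transpose F _); apply/funext => x.
  exact: mulNr.
move=> m; rewrite signD.
by case: n1 => ->; rewrite ?exprN1 ?invrN1 mulrN1 opprK.
Qed.

Lemma component_homogeneous n phi : hoch_homogeneous n (component n phi).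
Proof.
move=> x; rewrite /component /degree_scale; case: (_ =P n) => // _.
by rewrite mul0r eqxx.
Qed.

Lemma componentE m n phi : hoch_homogeneous n phi ->
  component m phi = if m == n then phi else 0.
Proof.
move=> hphi; rewrite /component (degree_scaleE _ hphi) eq_sym.
by case: eqP; rewrite ?scale1r ?scale0r.
Qed.

Lemma sum_component (s : seq int) phi : uniq s ->
  (forall x, phi x != 0 -> hgen_deg x \in s) ->
  \sum_(n <- s) component n phi = phi.
Proof.
move=> us phis; apply/funext => x.
have -> : (\sum_(n <- s) component n phi) x = \sum_(n <- s) component n phi x.
  by elim: s {us phis} => [|n s IH]; rewrite ?big_nil // !big_cons -IH.
rewrite /component /degree_scale -mulr_suml.
have [->|/phis xs] := eqVneq (phi x) 0; first by rewrite mulr0.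
rewrite (bigD1_seq _ xs us) /= eqxx big1 ?addr0 ?mul1r // => n nx.
by rewrite eq_sym (negPf nx).
Qed.

End Components.

Section SeriesComponents.
Variables (k : fieldType) (A : dgAlgebra k) (w : nat -> int).
Implicit Types (psi : series A).

Definition series_component (n : int) psi : series A :=
  fun j => component (n + w j) (psi j).

Lemma series_component_linear n : linear (series_component n).
Proof.
by move=> c f g; apply/funext => j; rewrite /series_component linearP.
Qed.
HB.instance Definition _ n := GRing.isLinear.Build k (series A) (series A) _
  (series_component n) (series_component_linear n).

Definition series_homogeneous (n : int) psi : Prop :=
  forall j, hoch_homogeneous (n + w j) (psi j).

Lemma series_componentE m n psi : series_homogeneous n psi ->
  series_component m psi = if m == n then psi else 0.
Proof.
move=> hpsi; apply/funext => j.
rewrite /series_component (componentE _ (hpsi j)).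
by rewrite (inj_eq (addIr _)); case: eqP.
Qed.

Lemma sum_series_component (s : seq int) psi :
  (forall j x, psi j x != 0 -> hgen_deg x - w j \in s) ->
  \sum_(n <- undup s) series_component n psi = psi.
Proof.
move=> psis; apply/funext => j.
rewrite -[RHS](@sum_component _ _ [seq n + w j | n <- undup s]).
- rewrite big_map; elim: (undup s) => [|n t IH]; first by rewrite !big_nil.
  by rewrite !big_cons -IH.
- by rewrite map_inj_uniq ?undup_uniq //; exact: addIr.
move=> x /psis xs; apply/mapP; exists (hgen_deg x - w j); last by rewrite subrK.
by rewrite mem_undup.
Qed.

End SeriesComponents.

Section SeriesSigns.
Variables (k : fieldType) (A : dgAlgebra k).

Definition series_sign (psi : series A) : series A :=
  fun j => sign_degree (psi j).

Lemma series_sign_linear : linear series_sign.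
Proof. by move=> c f g; apply/funext => j; rewrite /series_sign linearP. Qed.
HB.instance Definition _ := GRing.isLinear.Build k (series A) (series A) _
  series_sign series_sign_linear.

(** Powers of v have even degree, so signing each coefficient by its own degree signs the series by
    its total degree. *)
Lemma series_signE (w : nat -> int) n psi :
  (forall j, exists q, w j = 2 * q) ->
  series_homogeneous w n psi -> series_sign psi = (-1) ^ n *: psi.
Proof.
move=> w2 hpsi; apply/funext => j; have [q Eq] := w2 j.
rewrite /series_sign /sign_degree (degree_scaleE _ (hpsi j)) Eq.
by rewrite (@sign_eq _ q _ n).
Qed.

Lemma hoch_dv_sign (phi : cofun A) :
  hoch_dv (sign_degree phi) = - sign_degree (hoch_dv phi).
Proof.
rewrite (sign_degree_transpose _ (or_introl erefl) (@hoch_d_degree _ _)).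
by rewrite opprK.
Qed.

Lemma connes_Bv_sign (phi : cofun A) :
  connes_Bv (sign_degree phi) = - sign_degree (connes_Bv phi).
Proof.
rewrite (sign_degree_transpose _ (or_intror erefl) (@connes_B_degree _ _)).
by rewrite opprK.
Qed.

End SeriesSigns.

(** * The Connes exact sequences *)

Section ConnesSequences.
Variables (k : fieldType) (A : dgAlgebra k).
Implicit Types (phi y : cofun A) (psi v z : series A).

Lemma cocycleP (X : complex k) (x : ambient X) :
  reflect (x \in space X /\ diff X x = 0) (x \in cocycle X).
Proof.
by rewrite inE; apply: (iffP andP) => -[-> /eqP ->].
Qed.

Lemma connes_Bv_cocycle phi :
  phi \in cocycle (hochschild A) -> connes_Bv phi \in cocycle (hochschild A).
Proof.
move=> /cocycleP[phiC dphi]; apply/cocycleP; split.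
  exact: connes_Bv_cochain.
rewrite [LHS](hoch_dv_connes_Bv phiC); apply/eqP; rewrite oppr_eq0; apply/eqP.
rewrite -[RHS](linear0 (@connes_Bv k A)); congr (connes_Bv _); exact: dphi.
Qed.

Lemma HH_BE phi : phi \in cocycle (hochschild A) ->
  HH_B (@coh_class k (hochschild A) phi)
  = @coh_class k (hochschild A) (connes_Bv phi).
Proof.
apply: (@coh_mapE k (hochschild A) (hochschild A) (@connes_Bv k A)).
  exact: connes_Bv_cocycle.
move=> y yC _; exists (- connes_Bv y).
  by rewrite -scaleN1r rpredZ //; exact: connes_Bv_cochain.
by rewrite linearN /= (hoch_dv_connes_Bv yC) opprK.
Qed.

Fact cyc_v_linear : linear (@cyc_v k A).
Proof.
move=> c f g; apply/funext => -[|j] //=.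
exact/esym/(etrans (addr0 _))/scaler0.
Qed.
HB.instance Definition _ := GRing.isLinear.Build k (series A) (series A) _
  (@cyc_v k A) cyc_v_linear.

Fact cyc_mod_v_linear : linear (@cyc_mod_v k A).
Proof. by []. Qed.
HB.instance Definition _ := GRing.isLinear.Build k (series A) (cofun A) _
  (@cyc_mod_v k A) cyc_mod_v_linear.

Fact neg_v_linear : linear (@neg_v k A).
Proof. by []. Qed.
HB.instance Definition _ := GRing.isLinear.Build k (series A) (series A) _
  (@neg_v k A) neg_v_linear.

Fact neg_incl_linear : linear (@neg_incl k A).
Proof.
move=> c f g; apply/funext => -[|j] //=.
exact/esym/(etrans (addr0 _))/scaler0.
Qed.
HB.instance Definition _ := GRing.isLinear.Build k (cofun A) (series A) _
  (@neg_incl k A) neg_incl_linear.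

Lemma neg_incl_cyc phi : phi \in @cochain k A ->
  neg_incl phi \in @cyc_cochain k A.
Proof.
move=> phiC; apply/asboolP; split; last by exists 1%N => -[].
by case=> [|j] //=; exact: (rpred0 (@cochain k A)).
Qed.

Lemma neg_incl_neg phi : phi \in @cochain k A ->
  neg_incl phi \in @neg_cochain k A.
Proof.
move=> phiC; apply/asboolP; split.
  by case=> [|j] //=; exact: (rpred0 (@cochain k A)).
have /asboolP[_ _ _ [S phiS]] := phiC.
exists S => -[|j] x; last by rewrite eqxx.
by rewrite mulr0 addr0; exact: phiS.
Qed.

(** On the negative complex this shift is multiplication by v^-1, the section of [neg_v] used to
    compute the connecting map. *)
Lemma cyc_v_neg psi : psi \in @neg_cochain k A ->
  cyc_v psi \in @neg_cochain k A.
Proof.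
move=> /asboolP[psiC [S psiS]]; apply/asboolP; split.
  by case=> [|j] //=; exact: (rpred0 (@cochain k A)).
exists [seq n + 2 | n <- S] => -[|j] x; first by rewrite eqxx.
move=> /psiS xS; apply/mapP; exists (hgen_deg x + 2 * j%:Z) => //.
by rewrite -(addn1 j) PoszD; ring.
Qed.

Lemma neg_v_cyc psi : psi \in @cyc_cochain k A ->
  neg_v psi \in @cyc_cochain k A.
Proof.
move=> /asboolP[psiC [N psiN]]; apply/asboolP; split => [j|]; first exact: psiC.
by exists N => j Nj; apply: psiN; exact: leqW.
Qed.

Lemma cyc_D_neg_incl phi : phi \in cocycle (hochschild A) ->
  cyc_D (neg_incl phi) = cyc_v (neg_incl (connes_Bv phi)).
Proof.
move=> /cocycleP[_ dphi]; apply/funext => -[|[|j]]; rewrite /cyc_D /=.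
- by rewrite addr0; exact: dphi.
- by rewrite linear0 add0r.
- by rewrite !linear0 addr0.
Qed.

Lemma cyc_mod_v_cocycle z : z \in cocycle (cyclic A) ->
  cyc_mod_v z \in cocycle (hochschild A).
Proof.
move=> /cocycleP[/asboolP[zC _] dz]; apply/cocycleP; split; first exact: zC.
by rewrite -[LHS]addr0; exact: (congr1 (fun f => f 0%N) dz).
Qed.

Lemma HC_bE z : z \in cocycle (cyclic A) ->
  HC_b (@coh_class k (cyclic A) z) = @coh_class k (hochschild A) (cyc_mod_v z).
Proof.
apply: (@coh_mapE k (cyclic A) (hochschild A) (@cyc_mod_v k A)).
  exact: cyc_mod_v_cocycle.
move=> psi /asboolP[psiC _] _; exists (psi 0%N); first exact: psiC.
exact: addr0.
Qed.

(** The connecting map on cocycles: a constant cocycle phi has D phi = v B^v phi, to be divided by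
    v. *)
Definition cyc_delta : cofun A -> series A := @neg_incl k A \o @connes_Bv k A.
HB.instance Definition _ := GRing.Linear.on cyc_delta.

Lemma cyc_delta_cocycle phi : phi \in cocycle (hochschild A) ->
  cyc_delta phi \in cocycle (cyclic A).
Proof.
move=> phiZ; have /cocycleP[phiC _] := phiZ.
apply/cocycleP; split; first exact/neg_incl_cyc/connes_Bv_cochain.
rewrite [LHS](cyc_D_neg_incl (connes_Bv_cocycle phiZ)) connes_Bv_Bv //.
by rewrite linear0 [LHS]linear0.
Qed.

Lemma cyc_connecting_exact z v y :
  v \in space (cyclic A) -> y \in space (hochschild A) ->
  cyc_mod_v v = hoch_dv y -> cyc_v z = cyc_D v ->
  exists2 w, w \in space (cyclic A) & z = cyc_D w.
Proof.
move=> vC yC v0 zv.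
(* Dividing [cyc_D v] by the formal variable gives D ([neg_v v]) + B^v d^v y, and B^v d^v y = - d^v
   B^v y = - D (B^v y) since B^v B^v = 0. *)
exists (neg_v v - neg_incl (connes_Bv y)).
  apply: submodClosedB; first exact: neg_v_cyc.
  exact/neg_incl_cyc/connes_Bv_cochain.
have zE j : z j = cyc_D v j.+1 by rewrite -zv.
apply/funext => -[|j]; rewrite zE /cyc_D /=.
  rewrite -[v 0%N]/(cyc_mod_v v) v0 addr0 [X in _ = X]linearB.
  by rewrite /= hoch_dv_connes_Bv // opprK.
rewrite !linearB; case: j => [|j] /=; last by rewrite !linear0 !addr0.
by rewrite connes_Bv_Bv // !linear0 !addr0.
Qed.

Lemma HC_iE phi : phi \in cocycle (hochschild A) ->
  HC_i (@coh_class k (hochschild A) phi)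
  = @coh_class k (cyclic A) (cyc_delta phi).
Proof.
apply: (@connectingE k (cyclic A) (cyclic A) (hochschild A)
  (@cyc_v k A) (@cyc_mod_v k A) (@neg_incl k A) cyc_delta) => //.
- by move=> y /cocycleP[yC _]; exact: neg_incl_cyc.
- exact: cyc_delta_cocycle.
- by move=> y /cyc_D_neg_incl.
by move=> u v y vC yC _ _; exact: cyc_connecting_exact.
Qed.

Lemma neg_incl_cocycle phi : phi \in cocycle (hochschild A) ->
  neg_incl phi \in cocycle (negative_cyclic A).
Proof.
move=> /cocycleP[phiC dphi]; apply/cocycleP; split; first exact: neg_incl_neg.
by apply/funext => -[|j]; rewrite /= /neg_D /= !linear0 addr0.
Qed.

Lemma neg_D_neg_incl phi : neg_D (neg_incl phi) = neg_incl (hoch_dv phi).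
Proof. by apply/funext => -[|j]; rewrite /neg_D /= !linear0 addr0. Qed.

Lemma HCneg_iE phi : phi \in cocycle (hochschild A) ->
  HCneg_i (@coh_class k (hochschild A) phi)
  = @coh_class k (negative_cyclic A) (neg_incl phi).
Proof.
apply: (@coh_mapE k (hochschild A) (negative_cyclic A) (@neg_incl k A)).
  exact: neg_incl_cocycle.
move=> y yC _; exists (neg_incl y); first exact: neg_incl_neg.
by rewrite [RHS]neg_D_neg_incl.
Qed.

Definition neg_delta : series A -> cofun A := @connes_Bv k A \o @cyc_mod_v k A.
HB.instance Definition _ := GRing.Linear.on neg_delta.

(** Shifting a cocycle by v^-1 leaves D zero except in the new constant term, where only B^v z_0
    arrives. *)
Lemma neg_D_cyc_v z : z \in cocycle (negative_cyclic A) ->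
  neg_incl (neg_delta z) = neg_D (cyc_v z).
Proof.
move=> /cocycleP[_ dz]; apply/funext => -[|j]; rewrite /neg_D /=.
  by rewrite linear0 add0r.
exact/esym/(congr1 (fun f => f j) dz).
Qed.

Lemma neg_delta_cocycle z : z \in cocycle (negative_cyclic A) ->
  neg_delta z \in cocycle (hochschild A).
Proof.
move=> /cocycleP[/asboolP[zC _] dz]; apply/cocycleP; split.
  exact/connes_Bv_cochain/zC.
rewrite [LHS](hoch_dv_connes_Bv (zC 0%N)).
have /eqP := congr1 (fun f => f 0%N) dz.
rewrite addr_eq0 => /eqP; rewrite /cyc_mod_v => ->.
by rewrite linearN /= opprK connes_Bv_Bv.
Qed.

Lemma neg_connecting_exact phi v z :
  v \in space (negative_cyclic A) -> z \in space (negative_cyclic A) ->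
  neg_v v = neg_D z -> neg_incl phi = neg_D v ->
  exists2 w, w \in space (hochschild A) & phi = hoch_dv w.
Proof.
move=> /asboolP[vC _] /asboolP[zC _] vz phiv.
(* Here phi = d^v v_0 + B^v v_1 with v_1 = d^v z_0 + B^v z_1, so B^v v_1 = B^v d^v z_0 = - d^v B^v
   z_0. *)
exists (v 0%N - connes_Bv (z 0%N)).
  by apply: submodClosedB; [exact: vC|exact/connes_Bv_cochain/zC].
rewrite linearB /= hoch_dv_connes_Bv // opprK.
rewrite -[LHS]/(neg_incl phi 0%N) phiv /neg_D -[v 1%N]/(neg_v v 0%N) vz /neg_D.
by rewrite linearD /= connes_Bv_Bv // addr0.
Qed.

Lemma HCneg_bE z : z \in cocycle (negative_cyclic A) ->
  HCneg_b (@coh_class k (negative_cyclic A) z)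
  = @coh_class k (hochschild A) (neg_delta z).
Proof.
apply: (@connectingE k (hochschild A) (negative_cyclic A) (negative_cyclic A)
  (@neg_incl k A) (@neg_v k A) (@cyc_v k A) neg_delta) => //.
- by move=> y /cocycleP[yC _]; exact: cyc_v_neg.
- exact: neg_delta_cocycle.
- exact: neg_D_cyc_v.
by move=> u v y vC yC _ _; exact: neg_connecting_exact.
Qed.

End ConnesSequences.

(** * Gradings and sign operators on the two cyclic complexes *)

Section GradedConnes.
Variables (k : fieldType) (A : dgAlgebra k) (s : int).
Implicit Types (psi v z : series A).

Definition cyc_weight (j : nat) : int := 2 * j%:Z.
Definition neg_weight (j : nat) : int := - (2 * j%:Z).

Lemma series_component_homogeneous w n psi :
  series_homogeneous w n (series_component w n psi).
Proof. by move=> j; exact: component_homogeneous. Qed.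

Lemma cyc_component_space n psi : psi \in space (cyclic A) ->
  series_component cyc_weight n psi \in space (cyclic A).
Proof.
move=> /asboolP[psiC [N psiN]]; apply/asboolP; split=> [j|].
  exact: degree_scale_cochain.
by exists N => j /psiN; rewrite /series_component => ->; exact: linear0.
Qed.

Lemma neg_component_space n psi : psi \in space (negative_cyclic A) ->
  series_component neg_weight n psi \in space (negative_cyclic A).
Proof.
move=> /asboolP[psiC [S psiS]]; apply/asboolP; split=> [j|].
  exact: degree_scale_cochain.
by exists S => j x; rewrite mulf_eq0 negb_or => /andP[_ /psiS].
Qed.

Lemma series_sign_cyc psi : psi \in space (cyclic A) ->
  series_sign psi \in space (cyclic A).
Proof.
move=> /asboolP[psiC [N psiN]]; apply/asboolP; split=> [j|].
  exact: degree_scale_cochain.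
by exists N => j /psiN; rewrite /series_sign => ->; exact: linear0.
Qed.

Lemma series_sign_neg psi : psi \in space (negative_cyclic A) ->
  series_sign psi \in space (negative_cyclic A).
Proof.
move=> /asboolP[psiC [S psiS]]; apply/asboolP; split=> [j|].
  exact: degree_scale_cochain.
by exists S => j x; rewrite mulf_eq0 negb_or => /andP[_ /psiS].
Qed.

Lemma cyc_component_D n psi :
  series_component cyc_weight n (cyc_D psi)
  = cyc_D (series_component cyc_weight (n + 1) psi).
Proof.
apply/funext => j; rewrite /series_component /cyc_D linearD /=.
rewrite (component_transpose _ _ (@hoch_d_degree k A)) addrAC; congr (_ + _).
case: j => [|j]; first exact: linear0.
rewrite (component_transpose _ _ (@connes_B_degree k A)); congr (connes_Bv _).
congr (component _ _); rewrite /cyc_weight -(addn1 j) PoszD; ring.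
Qed.

Lemma neg_component_D n psi :
  series_component neg_weight n (neg_D psi)
  = neg_D (series_component neg_weight (n + 1) psi).
Proof.
apply/funext => j; rewrite /series_component /neg_D linearD /=.
rewrite (component_transpose _ _ (@hoch_d_degree k A)) addrAC; congr (_ + _).
rewrite (component_transpose _ _ (@connes_B_degree k A)); congr (connes_Bv _).
congr (component _ _); rewrite /neg_weight -(addn1 j) PoszD; ring.
Qed.

Lemma cyc_sign_D psi : cyc_D (series_sign psi) = - series_sign (cyc_D psi).
Proof.
apply/funext => j; rewrite /cyc_D /series_sign hoch_dv_sign.
rewrite -[RHS]/(- sign_degree _) linearD opprD; congr (_ + _).
by case: j => [|j]; rewrite ?connes_Bv_sign // !linear0.
Qed.

Lemma neg_sign_D psi : neg_D (series_sign psi) = - series_sign (neg_D psi).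
Proof.
apply/funext => j; rewrite /neg_D /series_sign hoch_dv_sign connes_Bv_sign.
by rewrite -[RHS]/(- sign_degree _) linearD opprD.
Qed.

Lemma HC_graded : graded_space (@HC_deg k A s).
Proof.
apply: (@graded_cohomology k (cyclic A) (fun n => series_component cyc_weight n)
  _ _ _ _ _ (fun n => n + 1 - s) (fun n => n - 1 + s)).
- exact: cyc_component_space.
- exact: series_component_homogeneous.
- exact: series_componentE.
- exact: cyc_component_D.
- move=> psi /asboolP[psiC [N psiN]].
  have /boolp.choice[S psiS] : forall j, exists S : seq int,
      forall x, psi j x != 0 -> hgen_deg x \in S.
    by move=> j; have /asboolP[] := psiC j.
  (* Only [N] coefficients can be nonzero, each with finitely many degrees n, contributing the total
     degrees n - 2j. *)
  exists (undup (flatten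
    [seq [seq n - cyc_weight j | n <- S j] | j <- iota 0 N])).
  apply/esym/sum_series_component => j x nz; apply/flatten_mapP; exists j.
    rewrite mem_iota /= ltnNge; apply: contra nz => /psiN ->.
    by rewrite eqxx.
  by apply/mapP; exists (hgen_deg x) => //; exact: psiS.
- by move=> n; ring.
- by move=> n; ring.
Qed.

Lemma HCneg_graded : graded_space (@HCneg_deg k A s).
Proof.
apply: (@graded_cohomology k (negative_cyclic A)
  (fun n => series_component neg_weight n)
  _ _ _ _ _ (fun n => n - s) (fun n => n + s)).
- exact: neg_component_space.
- exact: series_component_homogeneous.
- exact: series_componentE.
- exact: neg_component_D.
- move=> psi /asboolP[psiC [S psiS]]; exists (undup S).
  apply/esym/sum_series_component => j x /psiS.
  by rewrite /neg_weight opprK.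
- by move=> n; ring.
- by move=> n; ring.
Qed.

End GradedConnes.

Section AntiChainMap.
Variables (k : fieldType) (X : complex k).
Variable f : {linear ambient X -> ambient X}.
Hypothesis f_space : forall v, v \in space X -> f v \in space X.
Hypothesis f_diff : forall v, diff X (f v) = - f (diff X v).

Lemma anti_cocycle z : z \in cocycle X -> f z \in cocycle X.
Proof.
move=> /cocycleP[zC dz]; apply/cocycleP; split; first exact: f_space.
by rewrite f_diff dz linear0 oppr0.
Qed.

Lemma anti_exact y : y \in space X -> diff X y \in cocycle X ->
  exists2 y', y' \in space X & f (diff X y) = diff X y'.
Proof.
move=> yC _; exists (- f y); first by rewrite -scaleN1r rpredZ ?f_space.
by rewrite linearN /= f_diff opprK.
Qed.

Lemma anti_coh_mapE z : z \in cocycle X ->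
  coh_map f (coh_class z) = coh_class (f z).
Proof. exact: (coh_mapE anti_cocycle anti_exact). Qed.

Lemma anti_coh_map_linear : linear (@coh_map k X X f).
Proof. exact: linear_on_classes anti_cocycle anti_coh_mapE. Qed.

End AntiChainMap.

(** * Linearity, composites and degrees of b and i *)

Section ConnesMaps.
Variables (k : fieldType) (A : dgAlgebra k).

Definition HC_sign : HC A -> HC A :=
  @coh_map k (cyclic A) (cyclic A) (@series_sign k A).

Definition HCneg_sign : HCneg A -> HCneg A :=
  @coh_map k (negative_cyclic A) (negative_cyclic A) (@series_sign k A).

Lemma HC_signE z : z \in cocycle (cyclic A) ->
  HC_sign (@coh_class k (cyclic A) z) = @coh_class k (cyclic A) (series_sign z).
Proof.
apply: (@anti_coh_mapE k (cyclic A) (@series_sign k A)).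
  exact: series_sign_cyc.
exact: cyc_sign_D.
Qed.

Lemma HCneg_signE z : z \in cocycle (negative_cyclic A) ->
  HCneg_sign (@coh_class k (negative_cyclic A) z)
  = @coh_class k (negative_cyclic A) (series_sign z).
Proof.
apply: (@anti_coh_mapE k (negative_cyclic A) (@series_sign k A)).
  exact: series_sign_neg.
exact: neg_sign_D.
Qed.

Fact HC_sign_linear : linear HC_sign.
Proof.
apply: (@anti_coh_map_linear k (cyclic A) (@series_sign k A)).
  exact: series_sign_cyc.
exact: cyc_sign_D.
Qed.
HB.instance Definition _ :=
  GRing.isLinear.Build k (HC A) (HC A) _ HC_sign HC_sign_linear.

Fact HCneg_sign_linear : linear HCneg_sign.
Proof.
apply: (@anti_coh_map_linear k (negative_cyclic A) (@series_sign k A)).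
  exact: series_sign_neg.
exact: neg_sign_D.
Qed.
HB.instance Definition _ :=
  GRing.isLinear.Build k (HCneg A) (HCneg A) _ HCneg_sign HCneg_sign_linear.

Fact HC_b_linear : linear (@HC_b k A).
Proof.
apply: (@linear_on_classes k (cyclic A) (hochschild A) _
  (@cyc_mod_v k A)).
  exact: cyc_mod_v_cocycle.
exact: HC_bE.
Qed.
HB.instance Definition _ :=
  GRing.isLinear.Build k (HC A) (HH A) _ (@HC_b k A) HC_b_linear.

Fact HC_i_linear : linear (@HC_i k A).
Proof.
apply: (@linear_on_classes k (hochschild A) (cyclic A) _
  (@cyc_delta k A)).
  exact: cyc_delta_cocycle.
exact: HC_iE.
Qed.
HB.instance Definition _ :=
  GRing.isLinear.Build k (HH A) (HC A) _ (@HC_i k A) HC_i_linear.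

Fact HCneg_b_linear : linear (@HCneg_b k A).
Proof.
apply: (@linear_on_classes k (negative_cyclic A) (hochschild A) _
  (@neg_delta k A)).
  exact: neg_delta_cocycle.
exact: HCneg_bE.
Qed.
HB.instance Definition _ :=
  GRing.isLinear.Build k (HCneg A) (HH A) _ (@HCneg_b k A) HCneg_b_linear.

Fact HCneg_i_linear : linear (@HCneg_i k A).
Proof.
apply: (@linear_on_classes k (hochschild A) (negative_cyclic A) _
  (@neg_incl k A)).
  exact: neg_incl_cocycle.
exact: HCneg_iE.
Qed.
HB.instance Definition _ :=
  GRing.isLinear.Build k (HH A) (HCneg A) _ (@HCneg_i k A) HCneg_i_linear.

Lemma HC_bi a : HC_b (HC_i a) = @HH_B k A a.
Proof.
have [z zC ->] := coh_classP a.
by rewrite HC_iE // HC_bE ?HH_BE //; exact: cyc_delta_cocycle.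
Qed.

Lemma HC_ib x : @HC_i k A (HC_b x) = 0.
Proof.
have [z zC ->] := coh_classP x; have /cocycleP[zX dz] := zC.
have z0C := cyc_mod_v_cocycle zC.
rewrite HC_bE // HC_iE //; apply/coh_class_eq0; first exact: cyc_delta_cocycle.
(* This series has zero constant term, whence the 0, and the same D as the constant z_0 because [z]
   is a cocycle. *)
apply: (@cyc_connecting_exact _ _ _ (neg_incl (z 0%N) - z) 0).
- apply: submodClosedB => //; apply: neg_incl_cyc.
  by have /asboolP[zC0 _] := zX.
- exact: rpred0.
- by rewrite linear0 linearB /= /cyc_mod_v /= subrr.
rewrite linearB /= [X in _ - X]dz subr0; apply/esym.
exact: cyc_D_neg_incl.
Qed.

Lemma HCneg_bi a : HCneg_b (HCneg_i a) = @HH_B k A a.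
Proof.
have [z zC ->] := coh_classP a.
by rewrite HCneg_iE // HCneg_bE ?HH_BE //; exact: neg_incl_cocycle.
Qed.

Lemma HCneg_ib x : @HCneg_i k A (HCneg_b x) = 0.
Proof.
have [z zC ->] := coh_classP x; have /cocycleP[zX dz] := zC.
have dzC := neg_delta_cocycle zC.
rewrite HCneg_bE // HCneg_iE //; apply/coh_class_eq0.
  exact: neg_incl_cocycle.
by exists (cyc_v z); [exact: cyc_v_neg|exact: neg_D_cyc_v].
Qed.

Variable s : int.

Lemma connes_Bv_homogeneous n (phi : cofun A) :
  hoch_homogeneous n phi -> hoch_homogeneous (n + 1) (connes_Bv phi).
Proof.
move=> hphi x /(transpose_supp (S := [:: n]) (@connes_B_degree k A)).
rewrite inE => /(_ _)/eqP <-; first by rewrite subrK.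
by move=> y /hphi ->; rewrite inE.
Qed.

Lemma HC_b_degree n x : HC_deg s n x -> HH_deg s (n + 1) (@HC_b k A x).
Proof.
move=> [z [zC hz ->]]; exists (cyc_mod_v z); rewrite HC_bE //.
split=> //; first exact: cyc_mod_v_cocycle.
by have := hz 0%N; rewrite mulr0 addr0.
Qed.

Lemma HC_i_degree n a : HH_deg s n a -> HC_deg s n (@HC_i k A a).
Proof.
move=> [z [zC hz ->]]; exists (cyc_delta z); rewrite HC_iE //.
split=> //; first exact: cyc_delta_cocycle.
case=> [|j] x; last by rewrite eqxx.
rewrite mulr0 addr0 addrAC; move: x; exact: connes_Bv_homogeneous.
Qed.

Lemma HCneg_b_degree n x :
  HCneg_deg s n x -> HH_deg s (n + 1) (@HCneg_b k A x).
Proof.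
move=> [z [zC hz ->]]; exists (neg_delta z); rewrite HCneg_bE //.
split=> //; first exact: neg_delta_cocycle.
rewrite addrAC; apply: connes_Bv_homogeneous.
by have := hz 0%N; rewrite mulr0 subr0.
Qed.

Lemma HCneg_i_degree n a : HH_deg s n a -> HCneg_deg s n (@HCneg_i k A a).
Proof.
move=> [z [zC hz ->]]; exists (neg_incl z); rewrite HCneg_iE //.
split=> //; first exact: neg_incl_cocycle.
case=> [|j] x; last by rewrite eqxx.
rewrite mulr0 subr0; exact: hz.
Qed.

(** [series_sign] sees degrees before the shift; the offset 1 - s is the global sign that
    [BV_bracket] cancels. *)
Lemma HC_sign_degree n x : HC_deg s n x ->
  HC_sign x = (-1) ^ (n + (1 - s)) *: x.
Proof.
move=> [z [zC hz ->]]; rewrite HC_signE //.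
rewrite (@series_signE k A cyc_weight _ z _ hz); last by move=> j; exists j%:Z.
rewrite -[LHS]addr0 -[_ *: z]addr0 coh_class_linear ?rpred0 // coh_class0.
by rewrite !addr0 addrA.
Qed.

Lemma HCneg_sign_degree n x : HCneg_deg s n x ->
  HCneg_sign x = (-1) ^ (n - s) *: x.
Proof.
move=> [z [zC hz ->]]; rewrite HCneg_signE //.
rewrite (@series_signE k A neg_weight _ z _ hz); last first.
  by move=> j; exists (- j%:Z); rewrite mulrN.
rewrite -[_ *: z]addr0 coh_class_linear ?rpred0 // coh_class0.
by rewrite addr0.
Qed.

End ConnesMaps.

Theorem corollary8p2 (k : fieldType) (A : dgAlgebra k) (s : int)
    (cup : HH A -> HH A -> HH A)
    (BV : BV_algebra (@HH_deg k A s) cup (@HH_B k A)) :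
  (exists br : HC A -> HC A -> HC A,
      (forall (m : int) (x y : HC A), HC_deg s m x ->
         br x y = (-1) ^ m *: HC_i (cup (HC_b x) (HC_b y))) /\
      graded_lie_algebra (@HC_deg k A s) br) /\
  (exists br : HCneg A -> HCneg A -> HCneg A,
      (forall (m : int) (x y : HCneg A), HCneg_deg s m x ->
         br x y = (-1) ^ m *: HCneg_i (cup (HCneg_b x) (HCneg_b y))) /\
      graded_lie_algebra (@HCneg_deg k A s) br).
Proof.
split.
  exact: (BV_bracket (sign := @HC_sign k A) BV (@HC_graded k A s)
    (@HC_b_degree k A s) (@HC_i_degree k A s) (@HC_bi k A) (@HC_ib k A)
    (@HC_sign_degree k A s)).
exact: (BV_bracket (sign := @HCneg_sign k A) BV (@HCneg_graded k A s)
  (@HCneg_b_degree k A s) (@HCneg_i_degree k A s) (@HCneg_bi k A)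
  (@HCneg_ib k A) (@HCneg_sign_degree k A s)).
Qed.
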